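(* For $\beta\in\mathbf{C}$ with $0<|\beta|<1$, set $A_\beta=T_{1+\beta z}^{-1}T_{\overline z}T_{1+\beta z}$, an operator on the Hardy space $H^2$. As $|\beta|\to1^-$, $M(A_\beta)$ and $P(A_\beta)$ both grow in proportion to $\frac{1}{\sqrt{1-|\beta|}}$; that is, there exist constants $c,C>0$ and $r_0\in(0,1)$ such that for all $\beta$ with $r_0<|\beta|<1$, $$\frac{c}{\sqrt{1-|\beta|}}\le M(A_\beta)\le\frac{C}{\sqrt{1-|\beta|}}\quad\text{and}\quad \frac{c}{\sqrt{1-|\beta|}}\le P(A_\beta)\le\frac{C}{\sqrt{1-|\beta|}}.$$
   Context: $H^2$ is the Hardy space of the unit circle $\partial\mathbf{D}$: the closed linear span in $L^2(\partial\mathbf{D},\theta)$ ($d\theta$ being normalized arc length measure) of $\{z^n : n=0,1,2,\dots\}$, where $z(e^{it})=e^{it}$. For $f\in L^\infty(\partial\mathbf{D},\theta)$ the Toeplitz operator $T_f$ on $H^2$ is $T_fh=\mathcal{P}(fh)$, where $\mathcal{P}$ is the orthogonal projection of $L^2(\partial\mathbf{D},\theta)$ onto $H^2$. For a bounded operator $A$ with spectrum $\sigma(A)$ contained in the closed unit disk $\overline{\mathbf{D}}$, set $M(A)=\sup_{n\ge 0}\|A^n\|$ (over integers $n\geq 0$, with $A^0=I$) and $P(A)=\sup_{|\lambda|>1}\mathrm{dist}(\lambda,\sigma(A))\,\|(\lambda I-A)^{-1}\|$, norms being operator norms. *)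

(* Defs.v *)
From HB Require Import structures.
From mathcomp Require Import all_boot all_order all_algebra.
From mathcomp Require Import ring_quotient complex.
From mathcomp Require Import all_classical all_reals all_analysis.
From mathcomp Require Import measurable_realfun ess_sup_inf.

Set Implicit Arguments.
Unset Strict Implicit.
Unset Printing Implicit Defensive.

Import Order.TTheory GRing.Theory Num.Theory.
Import numFieldNormedType.Exports.
Import ComplexField.Normc.

Local Open Scope classical_set_scope.
Local Open Scope ring_scope.
Local Open Scope complex_scope.

Section Modulus.
Context (R : realType).
Implicit Types z w : R[i].

Lemma normc_ge0 z : 0 <= normc z.
Proof. by case: z => a b; exact: sqrtr_ge0. Qed.

Lemma normc_def z : `|z| = (normc z)%:C. Proof. by []. Qed.

Lemma ler_normcD z w : normc (z + w) <= normc z + normc w.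
Proof. exact: le_normcD. Qed.

Lemma normc_eq0 z : (normc z == 0) = (z == 0).
Proof. by apply/eqP/eqP => [/eq0_normc//|->]; exact: normc0. Qed.

Lemma ReM z w :
  complex.Re (z * w) = complex.Re z * complex.Re w - complex.Im z * complex.Im w.
Proof. by case: z w => a b [c d]. Qed.

Lemma ImM z w :
  complex.Im (z * w) = complex.Re z * complex.Im w + complex.Im z * complex.Re w.
Proof. by case: z w => a b [c d]. Qed.

Lemma ReD z w : complex.Re (z + w) = complex.Re z + complex.Re w.
Proof. by case: z w => a b [c d]. Qed.

Lemma ImD z w : complex.Im (z + w) = complex.Im z + complex.Im w.
Proof. by case: z w => a b [c d]. Qed.

Lemma normcE z : normc z = Num.sqrt (complex.Re z ^+ 2 + complex.Im z ^+ 2).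
Proof. by case: z. Qed.

End Modulus.

Section ComplexMeasurable.
Context d (T : measurableType d) (R : realType).
Implicit Types f g : T -> R[i].

Definition cmeasurable f :=
  measurable_fun setT (@complex.Re R \o f) /\
  measurable_fun setT (@complex.Im R \o f).

Lemma cmeasurable_cst c : cmeasurable (cst c).
Proof. by split; exact: measurable_cst. Qed.

Lemma cmeasurableD f g : cmeasurable f -> cmeasurable g -> cmeasurable (f \+ g).
Proof.
move=> [f1 f2] [g1 g2]; split.
- rewrite (_ : _ \o _ = (@complex.Re R \o f) \+ (@complex.Re R \o g)).
    exact: measurable_funD.
  by apply/funext => x; exact: ReD.
- rewrite (_ : _ \o _ = (@complex.Im R \o f) \+ (@complex.Im R \o g)).
    exact: measurable_funD.
  by apply/funext => x; exact: ImD.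
Qed.

Lemma cmeasurableM f g : cmeasurable f -> cmeasurable g -> cmeasurable (f \* g).
Proof.
move=> [f1 f2] [g1 g2]; split.
- rewrite (_ : _ \o _ = ((@complex.Re R \o f) \* (@complex.Re R \o g))
      \- ((@complex.Im R \o f) \* (@complex.Im R \o g))).
    by apply: measurable_funB; exact: measurable_funM.
  by apply/funext => x; exact: ReM.
- rewrite (_ : _ \o _ = ((@complex.Re R \o f) \* (@complex.Im R \o g))
      \+ ((@complex.Im R \o f) \* (@complex.Re R \o g))).
    by apply: measurable_funD; exact: measurable_funM.
  by apply/funext => x; exact: ImM.
Qed.

Lemma cmeasurable_normc f :
  cmeasurable f -> measurable_fun setT (@normc R \o f).
Proof.
move=> [f1 f2].
rewrite (_ : _ \o _ = Num.sqrt \o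
    (fun x => complex.Re (f x) ^+ 2 + complex.Im (f x) ^+ 2)).
  apply: measurableT_comp; first by apply: continuous_measurable_fun; exact: sqrt_continuous.
  by apply: measurable_funD; exact: measurable_funX.
by apply/funext => x; exact: normcE.
Qed.

End ComplexMeasurable.

Section LnormMonotone.
Context d (T : measurableType d) (R : realType).
Variables (mu : {measure set T -> \bar R}) (p : \bar R) (p1 : (1 <= p)%E).

Lemma ae_le_Lnorm (f g : T -> R) :
  measurable_fun setT f -> measurable_fun setT g ->
  (\forall x \ae mu, `|f x| <= `|g x|) ->
  ('N[mu]_p[EFin \o f] <= 'N[mu]_p[EFin \o g])%E.
Proof.
move=> mf mg fg; rewrite unlock /Lnorm; case: p p1 => [r r1||//].
- have r0 : 0 <= r by apply: (@le_trans _ _ 1); rewrite ?ler01// -lee_fin.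
  have mP (h : T -> R) : measurable_fun setT h ->
      measurable_fun setT (fun x => (`|(EFin \o h) x| `^ r)%E).
    move=> mh; apply: (measurableT_comp (measurable_poweR _)).
    by apply: measurableT_comp => //; exact/measurable_EFinP.
  have P0 (h : T -> R) : (\int[mu]_x (`|(EFin \o h) x| `^ r))%E \in `[0%E, +oo%E].
    by rewrite in_itv/= integral_ge0 ?leey// => x _; exact: poweR_ge0.
  apply: gt0_ler_poweR; rewrite ?invr_ge0 ?P0//.
  apply: ae_ge0_le_integral => //.
  + by move=> x _; exact: poweR_ge0.
  + exact: mP.
  + by move=> x _; exact: poweR_ge0.
  + exact: mP.
  + apply: filterS fg => x fg _; apply: gt0_ler_poweR => //=.
    * by rewrite in_itv/= lee_fin normr_ge0 leey.
    * by rewrite in_itv/= lee_fin normr_ge0 leey.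
- move=> _; case: ifPn => // mu0; apply: le_ess_sup.
  by apply: filterS fg => x /=; rewrite lee_fin.
Qed.
End LnormMonotone.

Section ComplexLp.
Context d (T : measurableType d) (R : realType).
Variables (mu : {measure set T -> \bar R}) (p : \bar R).
Local Notation C := R[i].

Definition clfun : {pred T -> C} :=
  mem [set f : T -> C | cmeasurable f /\ finite_norm mu p (@normc R \o f)].

Lemma clfunP (f : T -> C) :
  reflect (cmeasurable f /\ finite_norm mu p (@normc R \o f)) (f \in clfun).
Proof. by apply: (iffP idP); rewrite inE. Qed.

Hypothesis p1 : (1 <= p)%E.

Lemma clfun_dom (f : T -> C) (g : T -> R) : cmeasurable f ->
  measurable_fun setT g -> finite_norm mu p g ->
  (\forall x \ae mu, normc (f x) <= `|g x|) -> f \in clfun.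
Proof.
move=> mf mg fg le_fg; apply/clfunP; split=> //.
apply: le_lt_trans fg; apply: ae_le_Lnorm => //; first exact: cmeasurable_normc.
by apply: filterS le_fg => x /=; rewrite (ger0_norm (normc_ge0 _)).
Qed.

Lemma Lnorm_normcZ (a : C) (f : T -> C) : f \in clfun ->
  ('N[mu]_p[EFin \o (@normc R \o (a *: f))] =
   (normc a)%:E * 'N[mu]_p[EFin \o (@normc R \o f)])%E.
Proof.
move=> /clfunP[mf ff].
have fL : (@normc R \o f) \in Lfun mu p.
  by rewrite inE/=; apply/andP; split; rewrite inE//=; exact: cmeasurable_normc.
rewrite -[normc a]ger0_norm ?normc_ge0//.
rewrite -(LnormZ (Lfun_Sub p1 fL) (normc a)).
by apply: eq_Lnorm => x /=; rewrite normcM.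
Qed.

Lemma Lnorm_normcD (f g : T -> C) : cmeasurable f -> cmeasurable g ->
  ('N[mu]_p[EFin \o (@normc R \o (f + g)%R)] <=
   'N[mu]_p[EFin \o (@normc R \o f)] + 'N[mu]_p[EFin \o (@normc R \o g)])%E.
Proof.
move=> mf mg; have [nf ng] := (cmeasurable_normc mf, cmeasurable_normc mg).
apply: le_trans (eminkowski mu nf ng p1); apply: ae_le_Lnorm => //.
- by apply: cmeasurable_normc; exact: cmeasurableD.
- exact: measurable_funD.
- apply: aeW => x /=.
  by rewrite !ger0_norm ?addr_ge0 ?normc_ge0// ler_normcD.
Qed.

Lemma clfun_submod_closed : submod_closed clfun.
Proof.
split.
  apply/clfunP; split; first exact: cmeasurable_cst.
  rewrite /finite_norm (_ : _ \o _ = cst 0%E) ?Lnorm0//.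
    by rewrite gt_eqF// (lt_le_trans _ p1).
  by apply/funext => x; congr EFin; exact: normc0.
move=> a f g fL gL; have [[mf ff] [mg fg]] := (clfunP _ fL, clfunP _ gL).
have maf : cmeasurable (a *: f).
  by apply: (cmeasurableM _ mf); exact: cmeasurable_cst.
apply/clfunP; split; first exact: cmeasurableD.
apply: (le_lt_trans (Lnorm_normcD maf mg)); rewrite lte_add_pinfty//.
by rewrite Lnorm_normcZ// lte_mul_pinfty// lee_fin normc_ge0.
Qed.

End ComplexLp.

Section ComplexLpFun.
Context d (T : measurableType d) (R : realType).
Variables (mu : {measure set T -> \bar R}) (p : \bar R).
Local Notation C := R[i].

Record CLfun (p1 : (1 <= p)%E) :=
  MkCLfun { clfun_val :> T -> C ; clfun_valP : clfun_val \in clfun mu p }.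

Variable p1 : (1 <= p)%E.

HB.instance Definition _ := [isSub of CLfun p1 for @clfun_val p1].
HB.instance Definition _ := [Choice of CLfun p1 by <:].
#[local] HB.instance Definition _ :=
  GRing.isSubmodClosed.Build C (T -> C) (clfun mu p) (clfun_submod_closed mu p1).
HB.instance Definition _ := [SubChoice_isSubLmodule of CLfun p1 by <:].

Definition clnull : {pred CLfun p1} :=
  mem [set f : CLfun p1 | \forall x \ae mu, f x = 0].

Lemma clnullP (f : CLfun p1) :
  reflect (\forall x \ae mu, f x = 0) (f \in clnull).
Proof. by apply: (iffP idP); rewrite inE. Qed.

Lemma clnull_submod_closed : submod_closed clnull.
Proof.
split; first by apply/clnullP; apply: aeW.
move=> a f g /clnullP f0 /clnullP g0; apply/clnullP.
apply: filterS2 f0 g0 => x fx gx.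
by have -> : (a *: f + g) x = a * f x + g x by []; rewrite fx gx mulr0 addr0.
Qed.

HB.instance Definition _ := GRing.isSubmodClosed.Build C (CLfun p1) clnull
  clnull_submod_closed.

Definition CLspace : Type := Quotient.quot clnull.
HB.instance Definition _ := GRing.Zmodule.on CLspace.
HB.instance Definition _ := EqQuotient.on CLspace.

Definition clclass (f : CLfun p1) : CLspace := \pi_CLspace%qT f.
Definition clrepr (u : CLspace) : CLfun p1 := repr u.

Lemma clreprK u : clclass (clrepr u) = u.
Proof. exact: reprK. Qed.

Lemma clclassP (f g : CLfun p1) :
  clclass f = clclass g <-> \forall x \ae mu, f x = g x.
Proof.
split=> [/eqP|fg].
  rewrite -Quotient.idealrBE => /clnullP.
  apply: filterS => x; have -> : (f - g) x = f x - g x by [].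
  by move/eqP; rewrite subr_eq0 => /eqP.
apply/eqP; rewrite -Quotient.idealrBE; apply/clnullP.
apply: filterS fg => x fgx.
by have -> : (f - g) x = f x - g x by []; rewrite fgx subrr.
Qed.

Lemma clclassD f g : clclass (f + g) = clclass f + clclass g.
Proof. by rewrite /clclass raddfD. Qed.

Definition clscale (a : C) (u : CLspace) : CLspace := clclass (a *: clrepr u).

Lemma clscaleE a f : clscale a (clclass f) = clclass (a *: f).
Proof.
apply/clclassP; have /clclassP := clreprK (clclass f).
by apply: filterS => x fx; congr (a * _).
Qed.

Let clind (P : CLspace -> Prop) : (forall f, P (clclass f)) -> forall u, P u.
Proof. by move=> Pf u; rewrite -(clreprK u). Qed.

Let clscaleA a b u : clscale a (clscale b u) = clscale (a * b) u.
Proof. by elim/clind: u => f; rewrite !clscaleE scalerA. Qed.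

Let clscale1 : left_id 1 clscale.
Proof. by elim/clind => f; rewrite clscaleE scale1r. Qed.

Let clscaleDr : right_distributive clscale +%R.
Proof.
move=> a; elim/clind => f; elim/clind => g.
by rewrite -clclassD !clscaleE scalerDr clclassD.
Qed.

Let clscaleDl u : {morph clscale^~ u : a b / a + b}.
Proof.
by elim/clind: u => f a b; rewrite !clscaleE scalerDl clclassD.
Qed.

HB.instance Definition _ := GRing.Zmodule_isLmodule.Build C CLspace
  clscaleA clscale1 clscaleDr clscaleDl.

Lemma clclassZ a f : clclass (a *: f) = a *: clclass f.
Proof. by rewrite -clscaleE. Qed.

(* A normed module over [R[i]] has its norm in [R[i]]: the norm of [u] is
   [(clnorm u)%:C], and [complex.Re `|u|] recovers the real number. *)
Definition clnorm (u : CLspace) : R :=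
  fine ('N[mu]_p[EFin \o (@normc R \o clrepr u)]).

Let clfunmP (f : CLfun p1) := elimT (clfunP mu p _) (clfun_valP f).

Lemma clnorm_class (f : CLfun p1) :
  (clnorm (clclass f))%:E = ('N[mu]_p[EFin \o (@normc R \o f)])%E.
Proof.
have [mf ff] := clfunmP f; have [mg fg] := clfunmP (clrepr (clclass f)).
rewrite /clnorm fineK; last by rewrite ge0_fin_numE ?Lnorm_ge0.
have /clclassP fgE := clreprK (clclass f).
by apply/eqP; rewrite eq_le !ae_le_Lnorm//;
  do ?[exact: cmeasurable_normc]; apply: filterS fgE => x /= ->.
Qed.

Let clnormD u v : clnorm (u + v) <= clnorm u + clnorm v.
Proof.
elim/clind: u => f; elim/clind: v => g.
rewrite -clclassD -lee_fin EFinD !clnorm_class.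
by apply: Lnorm_normcD => //; exact: (clfunmP _).1.
Qed.

Let clnormZ a u : clnorm (a *: u) = normc a * clnorm u.
Proof.
elim/clind: u => f; apply: EFin_inj.
rewrite EFinM -clclassZ !clnorm_class -Lnorm_normcZ//.
exact: clfun_valP.
Qed.

Let clnorm0_eq0 u : clnorm u = 0 -> u = 0.
Proof.
elim/clind: u => f f0; have [mf _] := clfunmP f.
rewrite [RHS](_ : _ = clclass 0); last by rewrite /clclass raddf0.
apply/clclassP; have := clnorm_class f; rewrite f0 => /esym/Lnorm_eq0_eq0.
move=> /(_ _ (lt_le_trans lte01 p1)).
have /measurable_EFinP mnf := cmeasurable_normc mf; move=> /(_ mnf).
by apply: filterS => x /(_ I) [] /eq0_normc.
Qed.

Let clnormC_D u v : (clnorm (u + v))%:C <= (clnorm u)%:C + (clnorm v)%:C.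
Proof. by rewrite -rmorphD lecR. Qed.

Let clnormC_Z a u : (clnorm (a *: u))%:C = `|a| * (clnorm u)%:C.
Proof. by rewrite clnormZ rmorphM. Qed.

Let clnormC_eq0 u : (clnorm u)%:C = 0 -> u = 0.
Proof. by move=> [/clnorm0_eq0]. Qed.

HB.instance Definition _ := Lmodule_isNormed.Build C CLspace
  clnormC_D clnormC_Z clnormC_eq0.

Lemma clnormE (u : CLspace) : `|u| = (clnorm u)%:C.
Proof. by []. Qed.

End ComplexLpFun.

Notation L2 mu := (CLspace mu (lee1n 2)).

(* Essentially bounded measurable functions, kept as functions rather than
   classes since they only serve as multipliers. *)
Notation Linfty mu := (CLfun mu (leey 1)).

Section Multiplication.
Context d (T : measurableType d) (R : realType).
Variable (mu : {measure set T -> \bar R}).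
Local Notation C := R[i].

Lemma Linfty_bounded (f : Linfty mu) :
  exists M : R, \forall x \ae mu, normc (f x) <= M.
Proof.
have /clfunP[mf] := clfun_valP f; rewrite /finite_norm unlock /Lnorm.
case: ifPn => [mu0 ffin|]; last first.
  rewrite -leNgt => mu0 _; exists 0; exists setT; split => //.
  by apply/eqP; rewrite eq_le mu0 measure_ge0.
have [M fM] : exists M, \forall x \ae mu, Num.norm ((@normc R \o f) x) <= M.
  by apply: ess_supr_bounded.
by exists M; apply: filterS fM => x; apply: le_trans; exact: ler_norm.
Qed.

Section Mul.
Variables (p : \bar R) (p1 : (1 <= p)%E).

Lemma clmul_subproof (f : Linfty mu) (h : CLfun mu p1) :
  (f : T -> C) \* h \in clfun mu p.
Proof.
have /clfunP[mf _] := clfun_valP f; have /clfunP[mh _] := clfun_valP h.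
have [M fM] := Linfty_bounded f.
have /clfunP[mMh Mhfin] := clfun_valP (M%:C *: h).
apply: (clfun_dom p1 (cmeasurableM mf mh) _ Mhfin).
  exact: cmeasurable_normc.
apply: filterS fM => x fxM; rewrite /= ger0_norm ?normc_ge0//.
rewrite [in leRHS](_ : _ x = M%:C * h x)// !normcM.
apply: ler_wpM2r; first exact: normc_ge0.
apply: (le_trans fxM).
by rewrite normcE/= expr0n addr0 sqrtr_sqr ler_norm.
Qed.

(* The result does not depend on the representative of [u]. *)
Definition clmul (f : Linfty mu) (u : CLspace mu p1) : CLspace mu p1 :=
  clclass (MkCLfun p1 (clmul_subproof f (clrepr u))).

End Mul.

Definition cintegral (f : T -> C) : C :=
  (\int[mu]_x complex.Re (f x)) +i* (\int[mu]_x complex.Im (f x)).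

Definition inner (u v : L2 mu) : C :=
  cintegral (fun x => clrepr u x * (clrepr v x)^*).

End Multiplication.

Section BoundedFunctions.
Context d (T : measurableType d) (R : realType).
Variables (P : probability T R) (f : T -> R[i]) (M : R).
Hypotheses (mf : cmeasurable f) (fM : forall x, normc (f x) <= M).

Lemma bounded_clfun (p : \bar R) : (1 <= p)%E -> f \in clfun P p.
Proof.
move=> p1; apply: (@clfun_dom _ _ _ _ _ p1 _ (cst M)) => //; last first.
  by apply: aeW => x /=; rewrite (le_trans (fM x))// ler_norm.
rewrite /finite_norm unlock /Lnorm; case: p p1 => //= [r r1|_].
  rewrite integral_cst//= probability_setT mule1.
  by rewrite poweR_EFin ltry.
case: ifPn => // P0; apply: (@le_lt_trans _ _ `|M|%:E); last exact: ltry.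
by apply/ess_supP; apply: aeW => x /=.
Qed.

End BoundedFunctions.

Section Circle.
Variable R : realType.
Local Notation C := R[i].

(* The measurable sets are the traces of the Borel sets of the plane. *)
Record circle := MkCircle { circle_val :> C ; circle_valP : `|circle_val| == 1 }.

HB.instance Definition _ := [isSub for circle_val].
HB.instance Definition _ := [Choice of circle by <:].

Lemma circle1_subproof : `|1 : C| == 1. Proof. by rewrite normr1. Qed.
HB.instance Definition _ := isPointed.Build circle (MkCircle circle1_subproof).

Definition circle_coord (w : circle) : R * R := (complex.Re w, complex.Im w).

HB.instance Definition _ :=
  Measurable.copy circle (g_sigma_algebra_preimageType circle_coord).

Lemma measurable_circle_coord : measurable_fun setT circle_coord.
Proof. by move=> _ B mB; exists B. Qed.

Lemma cmeasurable_circle_val : cmeasurable circle_val.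
Proof. exact: (measurable_fun_pairP _).1 measurable_circle_coord. Qed.

Lemma normc_circle (w : circle) : normc w = 1.
Proof. by have /eqP[] := circle_valP w. Qed.

Lemma expi_subproof (t : R) : `|cos t +i* sin t| == 1.
Proof. by rewrite normc_def normcE/= cos2Dsin2 sqrtr1. Qed.

(* [measurableTypeR R] is [R] with the measurable structure over which
   [lebesgue_measure] and [uniform_prob] are defined. *)
Definition expi : measurableTypeR R -> circle :=
  fun t => MkCircle (expi_subproof t).

Lemma measurable_expi : measurable_fun setT expi.
Proof.
move=> _ _ [B mB <-]; rewrite setTI setTI.
have mcs : measurable_fun setT (fun t : measurableTypeR R => (cos t, sin t)).
  apply: measurable_fun_pair; apply: (@continuous_measurable_fun R).
    exact: continuous_cos.
  exact: continuous_sin.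
by rewrite -[X in measurable X]setTI; exact: mcs.
Qed.

HB.instance Definition _ :=
  @isMeasurableFun.Build _ _ (measurableTypeR R) circle expi measurable_expi.

Lemma twopi_gt0 : 0 < 2 * pi :> R.
Proof. by rewrite mulr_gt0// pi_gt0. Qed.

Definition arc_length : probability circle R :=
  distribution (uniform_prob twopi_gt0)
    (expi : {mfun measurableTypeR R >-> circle}).

End Circle.

Section LinearSpan.
Context (K : numFieldType) (V : normedModType K).
Implicit Types (S : set V).

Definition subspace_set S :=
  S 0 /\ forall a u v, S u -> S v -> S (a *: u + v).

Definition linear_span S : set V := smallest subspace_set S.

Lemma linear_span_subspace S : subspace_set (linear_span S).
Proof.
split=> [A [[A0 _] _]//|a u v Su Sv A SA].
by case: (SA) => -[_ AD] _; apply: AD; [exact: Su|exact: Sv].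
Qed.

Lemma closure_subspace S : subspace_set S -> subspace_set (closure S).
Proof.
move=> [S0 SD]; split; first exact: subset_closure.
have near u : closure S u <->
    forall e : K, 0 < e -> exists2 s, S s & `|u - s| < e.
  split=> [Su e e0|Su B].
    have [s [Ss us]] := Su _ (nbhsx_ballx u e e0).
    by exists s => //; move: us; rewrite -ball_normE.
  rewrite -nbhs_ballE => -[e /= e0 uB].
  by have [s Ss us] := Su e e0; exists s; split=> //; apply: uB; rewrite -ball_normE.
move=> a u v /near Su /near Sv; apply/near => e e0.
have a1 : 0 < `|a| + 1 by rewrite ltr_wpDl.
have [s Ss us] := Su _ (divr_gt0 (divr_gt0 e0 (ltr0Sn _ 1)) a1).
have [t St vt] := Sv _ (divr_gt0 e0 (ltr0Sn _ 1)).
exists (a *: s + t); first exact: SD.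
rewrite opprD addrACA -scalerBr [ltRHS](splitr e).
apply: le_lt_trans (ler_normD _ _) _; rewrite normrZ ler_ltD//.
apply: (@le_trans _ _ ((`|a| + 1) * `|u - s|)).
  by rewrite ler_wpM2r// lerDl.
by rewrite mulrC -ler_pdivlMr// ltW.
Qed.

End LinearSpan.

Section Hardy.
Variable R : realType.
Local Notation C := R[i].
Local Notation theta := (arc_length R).
Local Notation L2theta := (L2 theta).

Lemma monomial_subproof n :
  (fun w : circle R => (w : C) ^+ n) \in clfun theta 2%:E.
Proof.
apply: (@bounded_clfun _ _ _ theta _ 1) => [|w|]; last exact: lee1n.
  elim: n => [|n IHn]; first exact: cmeasurable_cst.
  rewrite (_ : (fun _ => _) = @circle_val R \* (fun w => (w : C) ^+ n)).
    by apply: cmeasurableM => //; exact: cmeasurable_circle_val.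
  by apply/funext => w; rewrite exprS.
elim: n => [|n IHn]; first by rewrite expr0 normc1.
by rewrite exprS normcM normc_circle mul1r.
Qed.

Definition monomial n : L2theta :=
  clclass (MkCLfun (lee1n 2) (monomial_subproof n)).

Definition hardy_set : set L2theta := closure (linear_span (range monomial)).

Record hardy := MkHardy { hardy_val :> L2theta ; hardyP : hardy_val \in hardy_set }.

HB.instance Definition _ := [isSub for hardy_val].
HB.instance Definition _ := [Choice of hardy by <:].

Lemma hardy_submod_closed : submod_closed (mem hardy_set : {pred L2theta}).
Proof.
have [h0 hD] := closure_subspace (linear_span_subspace (range monomial)).
split; first by rewrite inE.
by move=> a u v; rewrite !inE; exact: hD.
Qed.

HB.instance Definition _ := GRing.isSubmodClosed.Build C L2theta
  (mem hardy_set : {pred L2theta}) hardy_submod_closed.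
HB.instance Definition _ := [SubChoice_isSubLmodule of hardy by <:].

Let hardy_normD (u v : hardy) :
  `|hardy_val (u + v)| <= `|hardy_val u| + `|hardy_val v|.
Proof. exact: ler_normD. Qed.

Let hardy_normZ (a : C) (u : hardy) :
  `|hardy_val (a *: u)| = `|a| * `|hardy_val u|.
Proof. exact: normrZ. Qed.

Let hardy_norm0_eq0 (u : hardy) : `|hardy_val u| = 0 -> u = 0.
Proof. by move/normr0_eq0 => u0; exact: val_inj. Qed.

HB.instance Definition _ := Lmodule_isNormed.Build C hardy
  hardy_normD hardy_normZ hardy_norm0_eq0.

Definition hardy_proj (u : L2theta) : hardy :=
  xget 0 [set h : hardy | forall g : hardy, inner (u - hardy_val h) g = 0].

Definition toeplitz (f : Linfty theta) (h : hardy) : hardy :=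
  hardy_proj (clmul f h).

End Hardy.

Section BoundedOperators.
Variables (R : realType) (V : normedModType R[i]).
Implicit Types (A B : V -> V).

Definition bounded_operator A := linear A /\ continuous A.

Definition operator_inverse A B :=
  [/\ bounded_operator B, cancel A B & cancel B A].

(* The inverse in the algebra of bounded operators; by convention it is 0 when
   [A] is not invertible. *)
Definition inv_operator A : V -> V := xget (fun=> 0) (operator_inverse A).

Definition opnorm A : \bar R :=
  ereal_sup [set (complex.Re `|A x|)%:E | x in [set x | `|x| <= 1]].

Definition char_operator (l : R[i]) A : V -> V := fun x => l *: x - A x.

Definition spectrum A : set R[i] :=
  [set l | ~ exists B, operator_inverse (char_operator l A) B].

Definition cdist (l : R[i]) (S : set R[i]) : \bar R :=
  ereal_inf [set (normc (l - m))%:E | m in S].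

Definition power_bound A : \bar R :=
  ereal_sup (range (fun n => opnorm (iter n A))).

(* [inv_operator] is the resolvent off the spectrum; on the spectrum the
   distance vanishes, and so does the product. *)
Definition resolvent_bound A : \bar R :=
  ereal_sup [set (cdist l (spectrum A)
                  * opnorm (inv_operator (char_operator l A)))%E
            | l in [set l : R[i] | 1 < normc l]].

End BoundedOperators.

Section Symbols.
Variable R : realType.
Local Notation C := R[i].
Local Notation theta := (arc_length R).

Lemma conj_subproof : (fun w : circle R => (w : C)^*) \in clfun theta +oo%E.
Proof.
have [mr mi] := @cmeasurable_circle_val R.
apply: (@bounded_clfun _ _ _ theta _ 1) => [|w|]; last exact: leey.
  split; first by rewrite (_ : _ \o _ = @complex.Re R \o @circle_val R)//;
    apply/funext => w /=; case: (circle_val w).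
  rewrite (_ : _ \o _ = \- (@complex.Im R \o @circle_val R)).
    exact: measurable_funN.
  by apply/funext => w /=; case: (circle_val w).
by rewrite -(normc_circle w) /=; case: (circle_val w) => a b /=; rewrite sqrrN.
Qed.

Definition symbol_conj : Linfty theta := MkCLfun (leey 1) conj_subproof.

Lemma affine_subproof (b : C) :
  (fun w : circle R => 1 + b * (w : C)) \in clfun theta +oo%E.
Proof.
apply: (@bounded_clfun _ _ _ theta _ (1 + normc b)) => [|w|]; last exact: leey.
  apply: cmeasurableD; first exact: cmeasurable_cst.
  apply: cmeasurableM; first exact: cmeasurable_cst.
  exact: cmeasurable_circle_val.
apply: le_trans (ler_normcD _ _) _.
by rewrite normc1 normcM normc_circle mulr1.
Qed.

Definition symbol_affine (b : C) : Linfty theta :=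
  MkCLfun (leey 1) (affine_subproof b).

Definition A_beta (b : C) : hardy R -> hardy R :=
  inv_operator (toeplitz (symbol_affine b))
    \o toeplitz symbol_conj \o toeplitz (symbol_affine b).

End Symbols.

(* Main.v *)
Require Import Defs.
From mathcomp Require Import all_boot all_order all_algebra.
From mathcomp Require Import complex ring_quotient.
From mathcomp Require Import all_classical all_reals all_analysis.
From mathcomp Require Import measurable_realfun ring lra.
Import Order.TTheory GRing.Theory Num.Theory.
Import numFieldNormedType.Exports.
Import ComplexField.Normc.
Local Open Scope classical_set_scope.
Local Open Scope ring_scope.
Local Open Scope complex_scope.

(** On the Hardy space let [S] be the shift [h |-> z h], [B] the backward shift
    [h |-> (h - h(0)) / z] and [g = 1 / (1 + b z)]. The Toeplitz operators of
    [1 + b z] and of the conjugate of [z] are [1 + b S] and [B]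
    ([toeplitz_affine], [toeplitz_conj]), and since [h = h(0) + S B h],

      [A_beta b h = B h + b h(0) g] ([A_betaE]).

    Moreover [A_beta b g = 0], so the powers are as simple as the operator itself:
    for [n >= 1], the image of [h] under the [n]-th power is
    [B^n h + b (B^(n-1) h)(0) g] ([iter_A_beta]). In the same way, if [y] solves
    [l y - B y = h] with [|l| > 1], then
    [x = y + (b y(0) / l) g] solves [l x - A_beta b x = h]
    ([char_A_beta_solution]). As [B] is a contraction, the norm of [y] is at most
    that of [h] divided by [|l| - 1].

    Hence both suprema are at most [1 + |g|]. For the lower bounds, [A_beta b]
    sends the constant function 1 to [b g], and its resolvent at [l = 2] sends 1 to
    [1/2 + (b/4) g]. The spectrum is caught between the open and the closed unit
    disk: it contains the open disk because [A_beta b] has the eigenvectors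
    [g / (1 - m z)] ([spectrum_A_beta_lt]), so its distance to [l] is [|l| - 1].
    Finally [|g|^2 = 1 / (1 - |b|^2)] by the theorem of Pythagoras applied to
    [g = 1 - b S g] ([hnorm_szego]), which lies between
    [1 / (2 (1 - |b|))] and [1 / (1 - |b|)].

    The proof does not use the completeness of the Hardy space. The equations
    [u = h + m S u] and [u = h + m B u], for [|m| < 1], are first solved in the
    whole of L2: the former by multiplying by the bounded function
    [1 / (1 - m z)], the latter by correcting, with a rank one term, the solution
    obtained by multiplying by the conjugate kernel ([unimodular_resolvent],
    [backward_resolvent]). The solution belongs to the Hardy space because it is the
    limit of the partial sums of the Neumann series, which do
    ([resolvent_hardy]). That [S] and [B] preserve the Hardy space, and that
    [S h] is orthogonal to 1 for every [h] in it, follows by density from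
    the vanishing of the moments of arc length ([cintegral_circleX]). *)

(** * Moduli, measurability and the inner product *)

Section ComplexModulus.
Context {R : realType}.
Implicit Types z w : R[i].

Lemma normc_conjc z : normc (conjc z) = normc z.
Proof. by case: z => a b; rewrite /= sqrrN. Qed.

Lemma normc_sqr z : normc z ^+ 2 = complex.Re z ^+ 2 + complex.Im z ^+ 2.
Proof. by rewrite Defs.normcE sqr_sqrtr// addr_ge0 ?sqr_ge0. Qed.

Lemma mulcJ z : z * conjc z = (normc z ^+ 2)%:C.
Proof.
rewrite normc_sqr; case: z => a b; apply/eqP; rewrite eq_complex /=.
by apply/andP; split; apply/eqP; ring.
Qed.

Lemma conjcD z w : conjc (z + w) = conjc z + conjc w.
Proof. exact: rmorphD. Qed.

Lemma conjcM z w : conjc (z * w) = conjc z * conjc w.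
Proof. exact: rmorphM. Qed.

Lemma ler_normcB z w : normc z - normc w <= normc (z - w).
Proof. by rewrite lerBlDr (le_trans _ (ler_normcD _ _))// subrK. Qed.

Lemma normc_realC (x : R) : normc x%:C = `|x|.
Proof. by rewrite Defs.normcE/= expr0n addr0 sqrtr_sqr. Qed.

Lemma ler_abs_Re z : `|complex.Re z| <= normc z.
Proof. by rewrite Defs.normcE -sqrtr_sqr ler_wsqrtr// lerDl sqr_ge0. Qed.

Lemma ler_abs_Im z : `|complex.Im z| <= normc z.
Proof. by rewrite Defs.normcE -sqrtr_sqr ler_wsqrtr// lerDr sqr_ge0. Qed.

End ComplexModulus.

Section MeasurableOperations.
Context {d} {T : measurableType d} {R : realType}.
Implicit Types f : T -> R[i].

Lemma cmeasurable_conj f : cmeasurable f -> cmeasurable (fun x => conjc (f x)).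
Proof.
move=> [f1 f2]; split.
  by rewrite (_ : _ \o _ = @complex.Re R \o f)//; apply/funext => x /=; case: (f x).
rewrite (_ : _ \o _ = \- (@complex.Im R \o f)); first exact: measurable_funN.
by apply/funext => x /=; case: (f x).
Qed.

Lemma cmeasurable_inv f : cmeasurable f -> cmeasurable (fun x => (f x)^-1).
Proof.
move=> mf; have [f1 f2] := mf.
have mn : measurable_fun setT (fun x => (normc (f x) ^+ 2)^-1).
  rewrite (_ : (fun _ => _) = (fun r => r `^ (- 1)) \o (fun x => normc (f x) ^+ 2)).
    apply: measurableT_comp; first exact: measurable_powR.
    by apply: measurable_funX; exact: (cmeasurable_normc mf).
  by apply/funext => x /=; rewrite powR_inv1// exprn_ge0// normc_ge0.
split.
  rewrite (_ : _ \o _ =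
    (@complex.Re R \o f) \* (fun x => (normc (f x) ^+ 2)^-1)).
    exact: measurable_funM.
  by apply/funext => x /=; rewrite normc_sqr; case: (f x).
rewrite (_ : _ \o _ =
  \- ((@complex.Im R \o f) \* (fun x => (normc (f x) ^+ 2)^-1))).
  by apply: measurable_funN; exact: measurable_funM.
by apply/funext => x /=; rewrite normc_sqr; case: (f x).
Qed.

End MeasurableOperations.

Section InnerProduct.
Context {d} {T : measurableType d} {R : realType}.
Context {mu : {measure set T -> \bar R}}.
Local Notation fun2 := (CLfun mu (lee1n 2)).
Implicit Types (f g h : fun2) (u v w : L2 mu).

Lemma clclass_surj u : exists f, u = clclass f.
Proof. by exists (clrepr u); rewrite clreprK. Qed.

Lemma clnorm_ge0 u : 0 <= clnorm u.
Proof. by have := normr_ge0 u; rewrite clnormE lecR. Qed.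

Lemma clnormD u v : clnorm (u + v) <= clnorm u + clnorm v.
Proof. by have := ler_normD u v; rewrite !clnormE -rmorphD lecR. Qed.

Lemma clnormZ a u : clnorm (a *: u) = normc a * clnorm u.
Proof.
by have := normrZ a u; rewrite !clnormE Defs.normc_def -rmorphM => /complexI.
Qed.

Lemma clnorm0 : clnorm (0 : L2 mu) = 0.
Proof. by have := normr0 (L2 mu); rewrite clnormE => -[]. Qed.

Lemma clnorm_eq0 u : clnorm u = 0 -> u = 0.
Proof. by move=> u0; apply/eqP; rewrite -normr_eq0 clnormE u0. Qed.

Lemma clfun_cmeasurable f : cmeasurable f.
Proof. by have /clfunP[] := clfun_valP f. Qed.
Hint Resolve clfun_cmeasurable : core.

Lemma clfun_normc_Lfun f : (@normc R \o f) \in Lfun mu 2%:E.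
Proof.
have /clfunP[mf ff] := clfun_valP f.
by rewrite inE/=; apply/andP; split; rewrite inE//=; exact: cmeasurable_normc.
Qed.

(** Integrability of a complex function: that of its real and imaginary parts. *)
Definition cintegrable (F : T -> R[i]) :=
  mu.-integrable setT (EFin \o (fun x => complex.Re (F x))) /\
  mu.-integrable setT (EFin \o (fun x => complex.Im (F x))).

Lemma cintegrable_mulJ f g : cintegrable (fun x => f x * conjc (g x)).
Proof.
have mfg : cmeasurable (fun x => f x * conjc (g x)).
  by apply: cmeasurableM => //; exact: cmeasurable_conj.
have ifg : mu.-integrable setT (EFin \o (fun x => normc (f x) * normc (g x))).
  apply/Lfun1_integrable.
  exact: (Lfun2_mul_Lfun1 (clfun_normc_Lfun f) (clfun_normc_Lfun g)).
have [m1 m2] := mfg.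
split; apply: le_integrable ifg => //.
- exact/measurable_EFinP.
- move=> x _ /=; rewrite lee_fin (le_trans (ler_abs_Re _))//.
  by rewrite normcM normc_conjc ler_norm.
- exact/measurable_EFinP.
- move=> x _ /=; rewrite lee_fin (le_trans (ler_abs_Im _))//.
  by rewrite normcM normc_conjc ler_norm.
Qed.

Lemma cintegralD F G : cintegrable F -> cintegrable G ->
  cintegral mu (fun x => F x + G x) = @cintegral _ _ _ mu F + @cintegral _ _ _ mu G.
Proof.
move=> [F1 F2] [G1 G2]; rewrite /cintegral.
have -> : \int[mu]_x complex.Re (F x + G x) =
    \int[mu]_x (complex.Re (F x) + complex.Re (G x)).
  by apply: eq_Rintegral => x _; rewrite Defs.ReD.
have -> : \int[mu]_x complex.Im (F x + G x) =
    \int[mu]_x (complex.Im (F x) + complex.Im (G x)).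
  by apply: eq_Rintegral => x _; rewrite Defs.ImD.
by rewrite !RintegralD.
Qed.

Lemma cintegralZ a F : cintegrable F ->
  cintegral mu (fun x => a * F x) = a * @cintegral _ _ _ mu F.
Proof.
move=> [F1 F2]; rewrite /cintegral.
have -> : \int[mu]_x complex.Re (a * F x) = \int[mu]_x
    (complex.Re a * complex.Re (F x) - complex.Im a * complex.Im (F x)).
  by apply: eq_Rintegral => x _; rewrite Defs.ReM.
have -> : \int[mu]_x complex.Im (a * F x) = \int[mu]_x
    (complex.Re a * complex.Im (F x) + complex.Im a * complex.Re (F x)).
  by apply: eq_Rintegral => x _; rewrite Defs.ImM.
have iZ (r : R) (G : T -> R) : mu.-integrable setT (EFin \o G) ->
    mu.-integrable setT (EFin \o (fun x => r * G x)).
  by move=> iG; have := @integrableZl _ _ _ mu _ measurableT r _ iG.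
rewrite RintegralB ?RintegralD ?RintegralZl//; try exact: iZ.
by case: a => a b.
Qed.

Lemma cintegral_conj F : cintegrable F ->
  cintegral mu (fun x => conjc (F x)) = conjc (@cintegral _ _ _ mu F).
Proof.
move=> [F1 F2]; rewrite /cintegral.
have -> : \int[mu]_x complex.Re (conjc (F x)) = \int[mu]_x complex.Re (F x).
  by apply: eq_Rintegral => x _; case: (F x).
have -> : \int[mu]_x complex.Im (conjc (F x)) = \int[mu]_x ((-1) * complex.Im (F x)).
  by apply: eq_Rintegral => x _; rewrite mulN1r; case: (F x).
by rewrite RintegralZl// mulN1r.
Qed.

Lemma eq_ae_cintegral F G : cmeasurable F -> cmeasurable G ->
  (\forall x \ae mu, F x = G x) -> cintegral mu F = @cintegral _ _ _ mu G.
Proof.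
move=> [F1 F2] [G1 G2] FG; rewrite /cintegral /Rintegral.
congr (fine _ +i* fine _); apply: ae_eq_integral => //.
- exact/measurable_EFinP.
- exact/measurable_EFinP.
- by apply: filterS FG => x /= ->.
- exact/measurable_EFinP.
- exact/measurable_EFinP.
- by apply: filterS FG => x /= ->.
Qed.

(** The inner product may be computed on any representatives. *)
Lemma inner_class f g :
  inner (clclass f) (clclass g) = cintegral mu (fun x => f x * conjc (g x)).
Proof.
have mJ (f' g' : fun2) : cmeasurable (fun x => f' x * conjc (g' x)).
  by apply: cmeasurableM => //; exact: cmeasurable_conj.
rewrite /inner; apply: eq_ae_cintegral; [exact: mJ|exact: mJ|].
have /clclassP rf := clreprK (clclass f).
have /clclassP rg := clreprK (clclass g).
by apply: filterS2 rf rg => x -> ->.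
Qed.

Lemma innerDl u v w : inner (u + v) w = inner u w + inner v w.
Proof.
have [f ->] := clclass_surj u; have [g ->] := clclass_surj v; have [h ->] := clclass_surj w.
rewrite -clclassD !inner_class -cintegralD; try exact: cintegrable_mulJ.
by congr cintegral; apply/funext => x; rewrite -mulrDl.
Qed.

Lemma innerZl a u w : inner (a *: u) w = a * inner u w.
Proof.
have [f ->] := clclass_surj u; have [h ->] := clclass_surj w.
rewrite -clclassZ !inner_class -cintegralZ; last exact: cintegrable_mulJ.
by congr cintegral; apply/funext => x; rewrite mulrA.
Qed.

Lemma innerC u v : inner u v = conjc (inner v u).
Proof.
have [f ->] := clclass_surj u; have [g ->] := clclass_surj v.
rewrite !inner_class -cintegral_conj; last exact: cintegrable_mulJ.
by congr cintegral; apply/funext => x; rewrite conjcM conjcK mulrC.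
Qed.

Lemma inner_norm u : inner u u = (clnorm u ^+ 2)%:C.
Proof.
have [f ->] := clclass_surj u; rewrite inner_class /cintegral.
have -> : \int[mu]_x complex.Re (f x * conjc (f x)) = \int[mu]_x normc (f x) ^+ 2.
  by apply: eq_Rintegral => x _; rewrite mulcJ.
have -> : \int[mu]_x complex.Im (f x * conjc (f x)) = \int[mu]_x 0.
  by apply: eq_Rintegral => x _; rewrite mulcJ.
rewrite Rintegral_cst// mul0r complexr0; congr (_%:C).
rewrite /Rintegral; apply: EFin_inj.
have e : (\int[mu]_x (normc (f x) ^+ 2)%:E = ((clnorm (clclass f)) ^+ 2)%:E)%E.
  have := @powR_Lnorm _ _ _ mu (EFin \o (@normc R \o f)) 2 (lt0r_neq0 (ltr0Sn R 1)).
  rewrite -clnorm_class poweR_EFin powR_mulrn ?clnorm_ge0// => ->.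
  apply: eq_integral => x _ /=.
  by rewrite ger0_norm ?normc_ge0// powR_mulrn// normc_ge0.
by rewrite e.
Qed.

End InnerProduct.

Arguments inner : simpl never.
Arguments clmul : simpl never.
Arguments clclass : simpl never.

(** * Orthogonality and multiplication operators *)

Section InnerProductTheory.
Context {d} {T : measurableType d} {R : realType}.
Context {mu : {measure set T -> \bar R}}.
Implicit Types (u v w e : L2 mu).

Lemma innerDr u v w : inner u (v + w) = inner u v + inner u w.
Proof. by rewrite innerC innerDl conjcD -!innerC. Qed.

Lemma innerZr a u v : inner u (a *: v) = conjc a * inner u v.
Proof. by rewrite innerC innerZl conjcM -innerC. Qed.

Lemma inner0l v : inner 0 v = 0.
Proof. by have := innerZl 0 0 v; rewrite scaler0 mul0r. Qed.

Lemma innerBl u v w : inner (u - v) w = inner u w - inner v w.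
Proof. by rewrite innerDl -scaleN1r innerZl mulN1r. Qed.

Lemma inner_eq0 u : inner u u = 0 -> u = 0.
Proof.
by rewrite inner_norm => -[/eqP]; rewrite sqrf_eq0 => /eqP /clnorm_eq0.
Qed.

Lemma inner_orthC u v : inner u v = 0 -> inner v u = 0.
Proof. by rewrite innerC => uv; rewrite -[LHS]conjcK uv conjc0. Qed.

Lemma clnorm_orthD u v : inner u v = 0 ->
  clnorm (u + v) ^+ 2 = clnorm u ^+ 2 + clnorm v ^+ 2.
Proof.
move=> uv; apply/complexI; rewrite -inner_norm innerDl !innerDr uv.
by rewrite (inner_orthC _ _ uv) addr0 add0r !inner_norm -rmorphD.
Qed.

(** Pythagoras, for the projection of [u] onto the line of a unit vector. *)
Lemma clnorm_proj u e : clnorm e = 1 ->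
  clnorm u ^+ 2 = normc (inner u e) ^+ 2 + clnorm (u - inner u e *: e) ^+ 2.
Proof.
move=> e1; have ort : inner (inner u e *: e) (u - inner u e *: e) = 0.
  apply: inner_orthC; rewrite innerZr innerBl innerZl inner_norm e1.
  by rewrite expr1n mulr1 subrr mulr0.
by have := clnorm_orthD _ _ ort; rewrite clnormZ e1 mulr1 addrC subrK.
Qed.

Lemma ler_normc_inner u e : clnorm e = 1 -> normc (inner u e) <= clnorm u.
Proof.
move=> e1; rewrite -ler_sqr ?nnegrE ?normc_ge0 ?clnorm_ge0//.
by rewrite (clnorm_proj u e e1) lerDl sqr_ge0.
Qed.

Lemma ler_clnorm_proj u e : clnorm e = 1 ->
  clnorm (u - inner u e *: e) <= clnorm u.
Proof.
move=> e1; rewrite -ler_sqr ?nnegrE ?clnorm_ge0//.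
by rewrite [leRHS](clnorm_proj u e e1) lerDr sqr_ge0.
Qed.

Lemma clmul_class (phi : Linfty mu) (f : CLfun mu (lee1n 2)) :
  clmul phi (clclass f) =
  clclass (MkCLfun (lee1n 2) (clmul_subproof phi f)).
Proof.
apply/clclassP; have /clclassP := clreprK (clclass f).
by apply: filterS => x /= ->.
Qed.

Lemma clmulD (phi : Linfty mu) u v : clmul phi (u + v) = clmul phi u + clmul phi v.
Proof.
have [f ->] := clclass_surj u; have [g ->] := clclass_surj v.
rewrite -clclassD !clmul_class -clclassD; apply/clclassP; apply: aeW => x.
exact: mulrDr.
Qed.

Lemma clmulZ (phi : Linfty mu) a u : clmul phi (a *: u) = a *: clmul phi u.
Proof.
have [f ->] := clclass_surj u.
rewrite -clclassZ !clmul_class -clclassZ; apply/clclassP; apply: aeW => x.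
exact: mulrCA.
Qed.

Lemma clmulK (phi psi : Linfty mu) u :
  (forall x, phi x * psi x = 1) -> clmul phi (clmul psi u) = u.
Proof.
move=> phipsi; have [f ->] := clclass_surj u; rewrite !clmul_class; apply/clclassP.
by apply: aeW => x /=; rewrite mulrA phipsi mul1r.
Qed.

(** The symbol [a + b phi] multiplies by [a] plus [b] times multiplication by
    [phi]. *)
Lemma clmul_affine (phi chi : Linfty mu) a b u :
  (forall x, chi x = a + b * phi x) -> clmul chi u = a *: u + b *: clmul phi u.
Proof.
move=> chiE; have [f ->] := clclass_surj u; rewrite !clmul_class -!clclassZ -clclassD.
apply/clclassP; apply: aeW => x /=.
by rewrite chiE mulrDl -mulrA.
Qed.

Lemma inner_clmul (phi : Linfty mu) u v : (forall x, normc (phi x) = 1) ->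
  inner (clmul phi u) (clmul phi v) = inner u v.
Proof.
move=> phi1; have [f ->] := clclass_surj u; have [g ->] := clclass_surj v.
rewrite !clmul_class !inner_class; congr cintegral; apply/funext => x /=.
by rewrite conjcM mulrACA mulcJ phi1 expr1n mul1r.
Qed.

Lemma clnorm_clmul (phi : Linfty mu) u : (forall x, normc (phi x) = 1) ->
  clnorm (clmul phi u) = clnorm u.
Proof.
move=> phi1; apply/eqP; rewrite -(@eqrXn2 _ 2) ?clnorm_ge0//; apply/eqP.
by apply/complexI; rewrite -!inner_norm inner_clmul.
Qed.

End InnerProductTheory.

Section Resolvent.
Context {d} {T : measurableType d} {R : realType}.
Variable P : probability T R.

(** The solution is [h] times the function [1 / (1 - m phi)], which is bounded
    because [|m phi| < 1]. *)
Lemma unimodular_resolvent (phi : Linfty P) (m : R[i]) (h : L2 P) :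
  (forall x, normc (phi x) = 1) -> normc m < 1 ->
  exists w, w = h + m *: clmul phi w.
Proof.
move=> phi1 m1.
have m1' : 0 < 1 - normc m by rewrite subr_gt0.
have ge x : 1 - normc m <= normc (1 - m * phi x).
  apply: le_trans (ler_normcB _ _); rewrite normc1 lerD2l lerN2.
  by rewrite normcM phi1 mulr1.
have nz x : 1 - m * phi x != 0.
  by rewrite -normc_eq0 gt_eqF// (lt_le_trans m1').
have [mphi _] := clfunP P _ _ (clfun_valP phi).
have psiP : (fun x => (1 - m * phi x)^-1) \in clfun P +oo%E.
  apply: (@bounded_clfun _ _ _ P _ (1 - normc m)^-1) => [|x|]; last exact: leey.
    apply: cmeasurable_inv; rewrite (_ : (fun _ => _) =
      cst 1 \+ (cst (- m) \* phi)).
      apply: cmeasurableD; first exact: cmeasurable_cst.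
      by apply: cmeasurableM => //; exact: cmeasurable_cst.
    by apply/funext => x; rewrite /= mulNr.
  by rewrite normcV lef_pV2// posrE (lt_le_trans m1').
pose psi : Linfty P := MkCLfun (leey 1) psiP.
have chiP : (fun x => 1 + (- m) * phi x) \in clfun P +oo%E.
  apply: (@bounded_clfun _ _ _ P _ (1 + normc m)) => [|x|]; last exact: leey.
    apply: cmeasurableD; first exact: cmeasurable_cst.
    by apply: cmeasurableM => //; exact: cmeasurable_cst.
  by rewrite (le_trans (ler_normcD _ _))// normc1 mulNr normcN normcM phi1 mulr1.
pose chi : Linfty P := MkCLfun (leey 1) chiP.
exists (clmul psi h).
have chih : clmul chi (clmul psi h) = h.
  by apply: clmulK => x /=; rewrite mulNr mulfV.
rewrite -{2}chih (@clmul_affine _ _ _ _ phi chi 1 (- m))//.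
by rewrite scale1r scaleNr addrNK.
Qed.

End Resolvent.

(** * Moments of arc length *)

Section CircleMoments.
Context {R : realType}.
Local Notation theta := (arc_length R).

(** De Moivre's formula. *)
Lemma expiX (t : R) n :
  (expi t : R[i]) ^+ n = cos (n%:R * t) +i* sin (n%:R * t).
Proof.
elim: n => [|n IHn]; first by rewrite expr0 mul0r cos0 sin0.
rewrite exprS IHn -natr1 mulrDl mul1r cosD sinD /=.
by apply/eqP; rewrite eq_complex /=; apply/andP; split; apply/eqP; ring.
Qed.

Lemma expi_2pi n : (expi (2 * pi) : R[i]) ^+ n = 1.
Proof.
rewrite (_ : (expi _ : R[i]) = 1) ?expr1n//=.
by rewrite mulr_natl cos2pi sin2pi.
Qed.

(** A function on the circle that has, in the angle, an antiderivative with equal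
    values at [0] and [2 pi] has integral zero; that it is bounded by 1 is only a
    normalization. *)
Lemma arc_length_integral0 (g : circle R -> R) (G : R -> R) :
  measurable_fun setT g -> (forall w, `|g w| <= 1) ->
  (forall t : R, is_derive t 1 G (g (expi t))) -> continuous (fun t : R => g (expi t)) ->
  G (2 * pi) = G 0 -> \int[theta]_w g w = 0.
Proof.
move=> mg g1 dG cg GG.
(* The change of variables to the angle is available for nonnegative functions,
   hence the shift of [g] by 1. *)
have mg1 : measurable_fun setT (fun w => (1 + g w)%:E).
  by apply/measurable_EFinP; apply: measurable_funD.
have g1' w : (0 <= (1 + g w)%:E)%E.
  by rewrite lee_fin; have := g1 w; rewrite ler_norml => /andP[? _]; lra.
have i1 : (\int[theta]_w (1 + g w)%:E = 1)%E.
  rewrite ge0_integral_distribution// integral_uniform; last 2 first.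
  - exact: (measurableT_comp mg1 (@measurable_expi R)).
  - by move=> t; exact: g1'.
  have cF : continuous (fun t => t + G t).
    move=> t; apply: differentiable_continuous; apply/derivable1_diffP.
    by apply: derivableD => //; case: (dG t).
  transitivity ((2 * pi - 0)^-1%:E *
      ((2 * pi + G (2 * pi))%:E - (0 + G 0)%:E) : \bar R)%E.
    congr (_ * _)%E.
    apply: (@continuous_FTC2 _ (fun t : R => 1 + g (expi t)) (fun t => t + G t)).
    - exact: twopi_gt0.
    - apply: continuous_subspaceT => t.
      by apply: cvgD; [exact: cvg_cst|exact: cg].
    - split.
      + by move=> t _; apply: derivableD => //; case: (dG t).
      + by apply: cvg_at_right_filter; exact: cF.
      + by apply: cvg_at_left_filter; exact: cF.
    - move=> t _; rewrite derive1E.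
      exact: (@derive_val _ _ _ _ _ _ _ (is_deriveD (is_derive_id t 1) (dG t))).
  rewrite GG -EFinB -EFinM; congr EFin.
  by have := twopi_gt0 R => ?; field; lra.
have ig : theta.-integrable setT (EFin \o g).
  apply: measurable_bounded_integrable => //.
  - by apply: (@le_lt_trans _ _ 1%E); [exact: probability_le1|exact: ltry].
  - exists 1; split; first exact: num_real.
    by move=> M M1 w _; apply: (le_trans (g1 w)); exact: ltW.
have i1g : \int[theta]_w (1 + g w) = 1 by rewrite /Rintegral i1.
have iM : \int[theta]_w 1 = 1 :> R.
  rewrite (@Rintegral_cst _ _ _ theta setT measurableT 1) mul1r.
  by have := @probability_setT _ _ _ theta => /= ->.
have := @RintegralD _ _ _ theta setT (cst 1) g measurableT
  (finite_measure_integrable_cst _ _ measurableT) ig.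
by rewrite /= i1g iM => ?; lra.
Qed.

Lemma cmeasurable_circleX n : cmeasurable (fun w : circle R => (w : R[i]) ^+ n).
Proof. by have /clfunP[] := monomial_subproof R n. Qed.

Lemma normc_circleX (w : circle R) n : normc ((w : R[i]) ^+ n) = 1.
Proof.
elim: n => [|n IHn]; first by rewrite expr0 normc1.
by rewrite exprS normcM normc_circle mul1r.
Qed.

Lemma cintegral_circleX n : cintegral theta (fun w => (w : R[i]) ^+ n.+1) = 0.
Proof.
pose a : R := n.+1%:R.
have a0 : a != 0 by rewrite pnatr_eq0.
have [mr mi] := cmeasurable_circleX n.+1.
have Dlin (t : R) : is_derive t 1 (fun s : R => a * s) a.
  by apply: is_derive_eq; rewrite scaler1.
have cE (t : R) : complex.Re ((expi t : R[i]) ^+ n.+1) = cos (a * t).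
  by rewrite expiX.
have sE (t : R) : complex.Im ((expi t : R[i]) ^+ n.+1) = sin (a * t).
  by rewrite expiX.
have clin : continuous (fun t : R => a * t).
  by move=> t; apply: cvgM; [exact: cvg_cst|exact: cvg_id].
have e2 : cos (a * (2 * pi)) = 1 by rewrite -cE expi_2pi.
have e3 : sin (a * (2 * pi)) = 0 by rewrite -sE expi_2pi.
have dsin (t : R) : is_derive t 1 (fun t => a^-1 * sin (a * t)) (cos (a * t)).
  have ds := is_derive1_comp (is_derive_sin (a * t)) (Dlin t).
  have := @is_deriveZ _ _ _ _ a^-1 _ _ _ ds.
  by rewrite /GRing.scale/= mulrC mulfK.
have dcos (t : R) :
    is_derive t 1 (fun t => - (a^-1 * cos (a * t))) (sin (a * t)).
  have dc := is_derive1_comp (is_derive_cos (a * t)) (Dlin t).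
  have := @is_deriveN _ _ _ _ _ _ _ (@is_deriveZ _ _ _ _ a^-1 _ _ _ dc).
  by rewrite /GRing.scale/= mulrC mulfK// opprK.
have i1 : \int[theta]_w complex.Re ((w : R[i]) ^+ n.+1) = 0.
  apply: (@arc_length_integral0 _ (fun t => a^-1 * sin (a * t))) => //.
  - by move=> w; rewrite (le_trans (ler_abs_Re _))// normc_circleX.
  - by move=> t; rewrite cE.
  - under [X in continuous X]funext do rewrite cE.
    by move=> t; apply: continuous_comp; [exact: clin|exact: continuous_cos].
  - by rewrite e3 !mulr0 sin0 mulr0.
have i2 : \int[theta]_w complex.Im ((w : R[i]) ^+ n.+1) = 0.
  apply: (@arc_length_integral0 _ (fun t => - (a^-1 * cos (a * t)))) => //.
  - by move=> w; rewrite (le_trans (ler_abs_Im _))// normc_circleX.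
  - by move=> t; rewrite sE.
  - under [X in continuous X]funext do rewrite sE.
    by move=> t; apply: continuous_comp; [exact: clin|exact: continuous_sin].
  - by rewrite e2 mulr0 cos0.
by rewrite /cintegral i1 i2.
Qed.

End CircleMoments.

(** * Multiplication by the coordinate and density arguments *)

Section HardySpace.
Context {R : realType}.
Local Notation C := R[i].
Local Notation theta := (arc_length R).
Local Notation L2theta := (L2 theta).
Implicit Types (u v : L2theta) (h g : hardy R).

Lemma symbol_id_subproof : (fun w : circle R => (w : C)) \in clfun theta +oo%E.
Proof.
apply: (@bounded_clfun _ _ _ theta _ 1) => [|w|]; last exact: leey.
  exact: cmeasurable_circle_val.
by rewrite normc_circle.
Qed.

(** The coordinate [z] as a bounded symbol. *)
Definition symbol_id : Linfty theta := MkCLfun (leey 1) symbol_id_subproof.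

(** Multiplication by [z] and by its conjugate on the whole of L2; they are
    unitary and inverse to each other. *)
Definition zmul u := clmul symbol_id u.
Definition zbarmul u := clmul (symbol_conj R) u.

Lemma circle_mulJ (w : circle R) : (w : C) * conjc (w : C) = 1.
Proof. by rewrite mulcJ normc_circle expr1n. Qed.

Lemma zmulK u : zbarmul (zmul u) = u.
Proof. by apply: clmulK => w; rewrite mulrC; exact: circle_mulJ. Qed.

Lemma zbarmulK u : zmul (zbarmul u) = u.
Proof. by apply: clmulK => w; exact: circle_mulJ. Qed.

Lemma clnorm_zmul u : clnorm (zmul u) = clnorm u.
Proof. by apply: clnorm_clmul => w; exact: normc_circle. Qed.

Lemma clnorm_zbarmul u : clnorm (zbarmul u) = clnorm u.
Proof. by rewrite -clnorm_zmul zbarmulK. Qed.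

Lemma inner_zmul u v : inner (zmul u) (zmul v) = inner u v.
Proof. by apply: inner_clmul => w; exact: normc_circle. Qed.

Lemma zmul_monomial n : zmul (monomial R n) = monomial R n.+1.
Proof.
rewrite /zmul /monomial clmul_class; apply/clclassP; apply: aeW => w /=.
by rewrite exprS.
Qed.

Notation e0 := (monomial R 0).

Lemma clnorm_monomial n : clnorm (monomial R n) = 1.
Proof.
elim: n => [|n IHn]; last by rewrite -zmul_monomial clnorm_zmul.
apply/eqP; rewrite -(@eqrXn2 _ 2) ?clnorm_ge0//; apply/eqP/complexI.
rewrite -inner_norm inner_class expr1n /cintegral.
have -> : \int[theta]_w complex.Re ((w : C) ^+ 0 * conjc ((w : C) ^+ 0)) =
    \int[theta]_w 1.
  by apply: eq_Rintegral => w _; rewrite expr0 conjc1 mulr1.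
have -> : \int[theta]_w complex.Im ((w : C) ^+ 0 * conjc ((w : C) ^+ 0)) =
    \int[theta]_w 0.
  by apply: eq_Rintegral => w _; rewrite expr0 conjc1 mulr1.
rewrite !(@Rintegral_cst _ _ _ theta setT measurableT) mul0r mul1r.
by have := @probability_setT _ _ _ theta => /= ->.
Qed.

Lemma inner_monomialS n : inner (monomial R n.+1) e0 = 0.
Proof.
rewrite inner_class -[RHS](cintegral_circleX n); congr cintegral.
apply/funext => w; rewrite -[LHS]/((w : C) ^+ n.+1 * conjc ((w : C) ^+ 0)).
by rewrite expr0 conjc1 mulr1.
Qed.

Lemma hardy_set0 : hardy_set (0 : L2theta).
Proof. by have [] := closure_subspace (linear_span_subspace (range (monomial R))). Qed.

Lemma hardy_setP a u v : hardy_set u -> hardy_set v -> hardy_set (a *: u + v).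
Proof.
by have [_] := closure_subspace (linear_span_subspace (range (monomial R))); apply.
Qed.

Lemma hardy_set_monomial n : hardy_set (monomial R n).
Proof. by apply: subset_closure => A [_]; apply; exists n. Qed.

(** Closure points in terms of the real-valued norm. *)
Lemma closure_clnormP (A : set L2theta) u :
  closure A u <-> forall e : R, 0 < e -> exists2 s, A s & clnorm (u - s) < e.
Proof.
split=> [Au e e0|Au B].
  have [] := Au _ (nbhsx_ballx u e%:C _); first by rewrite ltcR.
  by move=> s [As]; rewrite -ball_normE /= clnormE ltcR; exists s.
rewrite -nbhs_ballE => -[e /= e0 uB].
have er : e = (complex.Re e)%:C by rewrite RRe_real// ger0_real// ltW.
have [|s As us] := Au (complex.Re e); first by rewrite -ltcR -er.
by exists s; split => //; apply: uB; rewrite -ball_normE /= clnormE er ltcR.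
Qed.

Lemma hardy_set_closed u :
  (forall e : R, 0 < e -> exists2 s, hardy_set s & clnorm (u - s) < e) ->
  hardy_set u.
Proof. by move=> /closure_clnormP; exact: closed_closure. Qed.

(** By density, a linear contraction of L2 which maps the monomials into the
    Hardy space preserves it. *)
Lemma contraction_hardy (F : L2theta -> L2theta) :
  (forall a u v, F (a *: u + v) = a *: F u + F v) ->
  (forall u, clnorm (F u) <= clnorm u) ->
  (forall n, hardy_set (F (monomial R n))) ->
  forall u, hardy_set u -> hardy_set (F u).
Proof.
move=> Flin Fle Fm u hu; apply: hardy_set_closed => e e0.
have FB v w : F (v - w) = F v - F w.
  by rewrite addrC -scaleN1r Flin scaleN1r addrC.
have F0 : F 0 = 0 by have := FB 0 0; rewrite !subrr.
have /closure_clnormP/(_ e e0)[s ss us] := hu.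
exists (F s); last by rewrite -FB (le_lt_trans (Fle _)).
apply: (ss [set v | hardy_set (F v)]); split; last by move=> _ [n _ <-]; exact: Fm.
split; first by rewrite /= F0; exact: hardy_set0.
by move=> a v w /= hv hw; rewrite Flin; exact: hardy_setP.
Qed.

(** By density, a linear functional of norm at most 1 which vanishes on the
    monomials vanishes on the Hardy space. *)
Lemma bounded_functional_hardy (F : L2theta -> C) :
  (forall a u v, F (a *: u + v) = a * F u + F v) ->
  (forall u, normc (F u) <= clnorm u) ->
  (forall n, F (monomial R n) = 0) ->
  forall u, hardy_set u -> F u = 0.
Proof.
move=> Flin Fle Fm u hu; apply/eqP; rewrite -normc_eq0; apply/eqP/le_anti.
rewrite normc_ge0 andbT; apply/ler_addgt0Pr => e e0; rewrite add0r.
have FB v w : F (v - w) = F v - F w.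
  by rewrite addrC -scaleN1r Flin mulN1r addrC.
have F0 : F 0 = 0 by have := FB 0 0; rewrite !subrr.
have /closure_clnormP/(_ e e0)[s ss us] := hu.
have Fs : F s = 0.
  apply: (ss [set v | F v = 0]); split; last by move=> _ [n _ <-]; exact: Fm.
  by split=> // a v w /= hv hw; rewrite Flin hv hw mulr0 addr0.
by rewrite -[F u]subr0 -Fs -FB (le_trans (Fle _))// ltW.
Qed.

(** If a contraction [F] preserves the Hardy space and [u = v + m F u] with
    [|m| < 1] and [v] in the Hardy space, then so is [u]: it is the limit of the
    partial sums of the series of the [m^k F^k v], the [n]-th remainder
    being [m^n F^n u]. *)
Lemma resolvent_hardy (F : L2theta -> L2theta) (m : C) u v :
  (forall u v, F (u - v) = F u - F v) ->
  (forall u, clnorm (F u) <= clnorm u) ->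
  (forall u, hardy_set u -> hardy_set (F u)) ->
  normc m < 1 -> hardy_set v -> u = v + m *: F u -> hardy_set u.
Proof.
move=> FB Fle Fh m1 hv uE.
have apx n : exists2 s, hardy_set s & clnorm (u - s) <= normc m ^+ n * clnorm u.
  elim: n => [|n [s hs us]].
    by exists 0; [exact: hardy_set0|rewrite subr0 expr0 mul1r].
  exists (v + m *: F s); first by rewrite addrC; apply: hardy_setP => //; exact: Fh.
  rewrite {1}uE opprD addrACA subrr add0r -scalerBr -FB clnormZ exprS -mulrA.
  by rewrite ler_wpM2l ?normc_ge0// (le_trans (Fle _)).
apply: hardy_set_closed => e e0.
have : (fun n => normc m ^+ n * clnorm u) @ \oo --> 0 * clnorm u.
  apply: cvgM; last exact: cvg_cst.
  by apply: cvg_expr; rewrite ger0_norm ?normc_ge0.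
rewrite mul0r => /cvgrPdist_lt/(_ e e0)[N _ /(_ N (leqnn N))].
rewrite sub0r normrN ger0_norm ?mulr_ge0 ?exprn_ge0 ?normc_ge0 ?clnorm_ge0// => lte.
by have [s hs us] := apx N; exists s => //; exact: le_lt_trans us lte.
Qed.

End HardySpace.

(** * The shift, the backward shift and two Toeplitz operators *)

Section Shifts.
Context {R : realType}.
Local Notation C := R[i].
Local Notation theta := (arc_length R).
Local Notation L2theta := (L2 theta).
Local Notation e0 := (monomial R 0).
Implicit Types (u v : L2theta) (h g : hardy R).

Lemma zmul_linear a u v : zmul (a *: u + v) = a *: zmul u + zmul v.
Proof. by rewrite /zmul clmulD clmulZ. Qed.

Lemma zbarmul_linear a u v : zbarmul (a *: u + v) = a *: zbarmul u + zbarmul v.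
Proof. by rewrite /zbarmul clmulD clmulZ. Qed.

Lemma zbarmul0 : zbarmul (0 : L2theta) = 0.
Proof. by have := clmulZ (symbol_conj R) 0 0; rewrite !scale0r. Qed.

(** The backward shift extended to the whole of L2: remove the constant term, then
    divide by [z]. On L2 it remains a contraction, although it is no longer a left
    inverse of [zmul]. *)
Definition backward u := zbarmul (u - inner u e0 *: e0).

Lemma backwardE u : backward u = zbarmul u - inner u e0 *: zbarmul e0.
Proof.
by rewrite /backward addrC -scaleNr zbarmul_linear scaleNr addrC.
Qed.

Lemma backward_linear a u v : backward (a *: u + v) = a *: backward u + backward v.
Proof.
rewrite !backwardE zbarmul_linear innerDl innerZl scalerDl scalerBr opprD addrACA.
by rewrite scalerA.
Qed.

Lemma backwardB u v : backward (u - v) = backward u - backward v.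
Proof. by rewrite addrC -scaleN1r backward_linear scaleN1r addrC. Qed.

Lemma ler_clnorm_backward u : clnorm (backward u) <= clnorm u.
Proof.
by rewrite /backward clnorm_zbarmul; apply: ler_clnorm_proj; exact: clnorm_monomial.
Qed.

Lemma backward_monomial0 : backward e0 = 0.
Proof.
by rewrite /backward inner_norm clnorm_monomial expr1n scale1r subrr zbarmul0.
Qed.

Lemma backward_monomialS n : backward (monomial R n.+1) = monomial R n.
Proof. by rewrite /backward inner_monomialS scale0r subr0 -zmul_monomial zmulK. Qed.

Lemma hardy_set_backward u : hardy_set u -> hardy_set (backward u).
Proof.
apply: contraction_hardy; [exact: backward_linear|exact: ler_clnorm_backward|].
case=> [|n]; first by rewrite backward_monomial0; exact: hardy_set0.
by rewrite backward_monomialS; exact: hardy_set_monomial.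
Qed.

Lemma hardy_set_zmul u : hardy_set u -> hardy_set (zmul u).
Proof.
apply: contraction_hardy; [exact: zmul_linear|by move=> v; rewrite clnorm_zmul|].
by move=> n; rewrite zmul_monomial; exact: hardy_set_monomial.
Qed.

Lemma inner_zmul_e0 u : hardy_set u -> inner (zmul u) e0 = 0.
Proof.
apply: (bounded_functional_hardy (fun v => inner (zmul v) e0)).
- by move=> a v w; rewrite zmul_linear innerDl innerZl.
- by move=> v; rewrite -(clnorm_zmul v); apply: ler_normc_inner; exact: clnorm_monomial.
- by move=> n; rewrite zmul_monomial inner_monomialS.
Qed.

Lemma hardy_valP h : hardy_set (hardy_val h).
Proof. by have := hardyP h; rewrite inE. Qed.

(** The shift [S] on the Hardy space. *)
Definition hardy_shift h : hardy R := MkHardy (mem_set (hardy_set_zmul _ (hardy_valP h))).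

(** The backward shift [B] on the Hardy space. *)
Definition hardy_coshift h : hardy R :=
  MkHardy (mem_set (hardy_set_backward _ (hardy_valP h))).

(** The constant function 1. *)
Definition hardy1 : hardy R := MkHardy (mem_set (hardy_set_monomial 0)).

(** The value of [h] at the origin, as its zeroth Fourier coefficient. *)
Definition hardy_coef0 h : C := inner (hardy_val h) e0.

(** The norm of the Hardy space, as a real number. *)
Definition hnorm h : R := clnorm (hardy_val h).

Lemma shift_linear a h g : hardy_shift (a *: h + g) = a *: hardy_shift h + hardy_shift g.
Proof. by apply: val_inj; exact: zmul_linear. Qed.

Lemma coshift_linear a h g : hardy_coshift (a *: h + g) = a *: hardy_coshift h + hardy_coshift g.
Proof. by apply: val_inj; exact: backward_linear. Qed.

Lemma hardy_coef0_linear a h g : hardy_coef0 (a *: h + g) = a * hardy_coef0 h + hardy_coef0 g.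
Proof. by rewrite /hardy_coef0 -innerZl -innerDl. Qed.

Lemma shiftK h : hardy_coshift (hardy_shift h) = h.
Proof.
apply: val_inj; rewrite /= /backward inner_zmul_e0; last exact: hardy_valP.
by rewrite scale0r subr0 zmulK.
Qed.

Lemma coshiftK h : hardy_shift (hardy_coshift h) = h - hardy_coef0 h *: hardy1.
Proof. by apply: val_inj; rewrite /= /backward zbarmulK. Qed.

Lemma coshift1 : hardy_coshift hardy1 = 0.
Proof. by apply: val_inj; exact: backward_monomial0. Qed.

Lemma hnormE h : `|h| = (hnorm h)%:C. Proof. by []. Qed.

Lemma hnorm_ge0 h : 0 <= hnorm h. Proof. exact: clnorm_ge0. Qed.

Lemma ler_hnormD h g : hnorm (h + g) <= hnorm h + hnorm g.
Proof. exact: clnormD. Qed.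

Lemma hnormZ a h : hnorm (a *: h) = normc a * hnorm h.
Proof. exact: clnormZ. Qed.

Lemma hnorm_opp h : hnorm (- h) = hnorm h.
Proof. by rewrite -scaleN1r hnormZ normcN normc1 mul1r. Qed.

Lemma hnorm_eq0 h : hnorm h = 0 -> h = 0.
Proof. by move=> /clnorm_eq0 h0; apply: val_inj. Qed.

Lemma hnorm1 : hnorm hardy1 = 1. Proof. exact: clnorm_monomial. Qed.

Lemma hnorm_shift h : hnorm (hardy_shift h) = hnorm h. Proof. exact: clnorm_zmul. Qed.

Lemma ler_hnorm_coshift h : hnorm (hardy_coshift h) <= hnorm h.
Proof. exact: ler_clnorm_backward. Qed.

Lemma ler_normc_coef0 h : normc (hardy_coef0 h) <= hnorm h.
Proof. by apply: ler_normc_inner; exact: clnorm_monomial. Qed.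

(** Constants are orthogonal to the range of the shift. *)
Lemma hnorm_split a h : hnorm (a *: hardy1 + hardy_shift h) ^+ 2 = normc a ^+ 2 + hnorm h ^+ 2.
Proof.
rewrite /hnorm -(clnorm_zmul (hardy_val h)).
have -> : normc a = clnorm (a *: e0) by rewrite clnormZ clnorm_monomial mulr1.
apply: clnorm_orthD; rewrite innerZl (inner_orthC _ _ (inner_zmul_e0 _ (hardy_valP h))).
by rewrite mulr0.
Qed.

Lemma coshiftD h g : hardy_coshift (h + g) = hardy_coshift h + hardy_coshift g.
Proof. by have := coshift_linear 1 h g; rewrite !scale1r. Qed.

Lemma coshift0 : hardy_coshift (0 : hardy R) = 0.
Proof.
by have /esym/eqP := coshiftD 0 0; rewrite addr0 -subr_eq0 addrK => /eqP.
Qed.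

Lemma hardy_coef0_shift h : hardy_coef0 (hardy_shift h) = 0.
Proof. by apply: inner_zmul_e0; exact: hardy_valP. Qed.

Lemma hardy_coef0_1 : hardy_coef0 (hardy1 : hardy R) = 1.
Proof. by rewrite /hardy_coef0 inner_norm clnorm_monomial expr1n. Qed.

Lemma hardy_coef0D h g : hardy_coef0 (h + g) = hardy_coef0 h + hardy_coef0 g.
Proof. by have := hardy_coef0_linear 1 h g; rewrite scale1r mul1r. Qed.

Lemma hardy_coef0Z a h : hardy_coef0 (a *: h) = a * hardy_coef0 h.
Proof. exact: innerZl. Qed.

Lemma hardy_shift0 : hardy_shift (0 : hardy R) = 0.
Proof. by apply: hnorm_eq0; rewrite hnorm_shift; exact: clnorm0. Qed.

Lemma hardy_shiftZ a h : hardy_shift (a *: h) = a *: hardy_shift h.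
Proof. by apply: val_inj; exact: clmulZ. Qed.

Lemma coshiftZ a h : hardy_coshift (a *: h) = a *: hardy_coshift h.
Proof. by have := coshift_linear a h 0; rewrite coshift0 !addr0. Qed.

(** A vector of the Hardy space that satisfies the orthogonality relations of the
    projection is the projection. *)
Lemma hardy_proj_eq u h :
  (forall g, inner (u - hardy_val h) (hardy_val g) = 0) -> hardy_proj u = h.
Proof.
move=> uh; rewrite /hardy_proj; case: xgetP => [p _ up|]; last first.
  by move=> /(_ h); case.
have e : hardy_val p - hardy_val h = (u - hardy_val h) - (u - hardy_val p).
  by rewrite opprB [RHS]addrC addrA addrNK.
have d : inner (hardy_val p - hardy_val h) (hardy_val (p - h)) = 0.
  by rewrite e innerBl uh up subrr.
apply: val_inj; apply/eqP; rewrite -subr_eq0; apply/eqP; exact: inner_eq0 d.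
Qed.

Lemma toeplitz_affine b h : toeplitz (symbol_affine b) h = h + b *: hardy_shift h.
Proof.
apply: hardy_proj_eq => g.
rewrite (@clmul_affine _ _ _ _ symbol_id (symbol_affine b) 1 b)//.
by rewrite scale1r subrr inner0l.
Qed.

(** What the projection removes from [h / z] is a multiple of [1 / z], which is
    orthogonal to the Hardy space. *)
Lemma toeplitz_conj h : toeplitz (symbol_conj R) h = hardy_coshift h.
Proof.
apply: hardy_proj_eq => g.
rewrite -/(zbarmul (hardy_val h)) /= backwardE opprB addrC addrNK innerZl.
rewrite -(inner_zmul (zbarmul e0)) zbarmulK (inner_orthC _ _ (inner_zmul_e0 _ (hardy_valP g))).
by rewrite mulr0.
Qed.

Lemma shift_resolvent (m : C) h : normc m < 1 -> exists g, g = h + m *: hardy_shift g.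
Proof.
move=> m1.
have [w wE] := @unimodular_resolvent _ _ _ theta symbol_id m (hardy_val h)
  (@normc_circle R) m1.
have hw : hardy_set w.
  apply: (resolvent_hardy zmul m w (hardy_val h)) => //.
  - by move=> u v; rewrite addrC -scaleN1r zmul_linear scaleN1r addrC.
  - by move=> u; rewrite clnorm_zmul.
  - exact: hardy_set_zmul.
  - exact: hardy_valP.
by exists (MkHardy (mem_set hw)); apply: val_inj.
Qed.

(** On L2, [backward] differs from multiplication by the conjugate [J] of [z]
    by a rank one operator. Let [F] and [E] solve [F = v + m J F] and
    [E = 1 + m J E]; then [u = F - t J E] solves the equation for the [t] such
    that [t = m <u, 1>]. *)
Lemma backward_resolvent (m : C) v : normc m < 1 -> exists u, u = v + m *: backward u.
Proof.
move=> m1.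
have phi1 (x : circle R) : normc (symbol_conj R x) = 1.
  by rewrite normc_conjc normc_circle.
have [F FE] := @unimodular_resolvent _ _ _ theta (symbol_conj R) m v phi1 m1.
have [E EE] := @unimodular_resolvent _ _ _ theta (symbol_conj R) m e0 phi1 m1.
rewrite -/(zbarmul F) in FE; rewrite -/(zbarmul E) in EE.
have JE : zbarmul E = zbarmul e0 + m *: zbarmul (zbarmul E).
  by rewrite {1}EE addrC zbarmul_linear addrC.
set k := inner (zbarmul E) e0.
(* The equation for [t] is solvable: otherwise [J E] would be a nonzero vector
   with [J E = m backward (J E)], against the contractivity of [backward]. *)
have nz : 1 + m * k != 0.
  apply/eqP => k0.
  have JEfix : zbarmul E = m *: backward (zbarmul E).
    rewrite backwardE -/k scalerBr scalerA.
    have -> : m * k = -1 by apply/eqP; rewrite -addr_eq0 addrC k0.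
    by rewrite scaleN1r opprK addrC -JE.
  have JE0 : zbarmul E = 0.
    apply: clnorm_eq0; apply/le_anti; rewrite clnorm_ge0 andbT.
    have : clnorm (zbarmul E) <= normc m * clnorm (zbarmul E).
      rewrite {1}JEfix clnormZ ler_wpM2l ?normc_ge0//; exact: ler_clnorm_backward.
    by have := clnorm_ge0 (zbarmul E); nra.
  by move: k0; rewrite /k JE0 inner0l mulr0 addr0 => /eqP; rewrite oner_eq0.
pose t := m * inner F e0 / (1 + m * k).
have tE : m * inner (F - t *: zbarmul E) e0 = t.
  rewrite innerBl innerZl -/k.
  have : t * (1 + m * k) = m * inner F e0 by rewrite /t mulfVK.
  move=> e; rewrite mulrBr -e; ring.
exists (F - t *: zbarmul E).
rewrite backwardE scalerBr scalerA tE.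
have -> : zbarmul (F - t *: zbarmul E) = zbarmul F - t *: zbarmul (zbarmul E).
  by rewrite addrC -scaleNr zbarmul_linear scaleNr addrC.
rewrite [LHS](_ : _ = v + m *: zbarmul F - t *: (zbarmul e0 + m *: zbarmul (zbarmul E))).
  rewrite scalerBr scalerDr opprD !scalerA (mulrC m t) -!addrA.
  by congr (_ + (_ + _)); rewrite addrC.
by rewrite -FE -JE.
Qed.

Lemma coshift_resolvent (m : C) h : normc m < 1 -> exists g, g = h + m *: hardy_coshift g.
Proof.
move=> m1; have [w wE] := backward_resolvent m (hardy_val h) m1.
have hw : hardy_set w.
  apply: (resolvent_hardy backward m w (hardy_val h)) => //.
  - exact: backwardB.
  - exact: ler_clnorm_backward.
  - exact: hardy_set_backward.
  - exact: hardy_valP.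
by exists (MkHardy (mem_set hw)); apply: val_inj.
Qed.

End Shifts.

(** * Norms and inverses of operators *)

Section Operators.
Context {R : realType}.
Local Notation C := R[i].
Implicit Types (h g : hardy R) (A B : hardy R -> hardy R).

Lemma linear_bounded_continuous_hardy A (K : R) :
  linear A -> (forall h, hnorm (A h) <= K * hnorm h) -> continuous A.
Proof.
move=> linA AK x U; rewrite -nbhs_ballE => -[e /= e0 eU].
have er : e = (complex.Re e)%:C by rewrite RRe_real// ger0_real// ltW.
have r0 : 0 < complex.Re e by rewrite -ltcR -er.
have K0 : 0 < `|K| + 1 by rewrite ltr_wpDl.
exists (complex.Re e / (`|K| + 1))%:C => /=.
  by rewrite ltcR divr_gt0.
move=> y; rewrite -ball_normE /= hnormE ltcR ltr_pdivlMr// => xy.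
apply: eU; rewrite -ball_normE /= hnormE er ltcR.
have <- : A (x - y) = A x - A y.
  by rewrite addrC -scaleN1r linA scaleN1r addrC.
apply: le_lt_trans xy; apply: le_trans (AK _) _.
rewrite mulrC ler_wpM2l ?hnorm_ge0//.
by rewrite (le_trans (ler_norm K))// lerDl.
Qed.

(** A surjective linear operator that is bounded below is invertible, with a
    bounded inverse. *)
Lemma bounded_below_inverse A (c : R) : linear A -> 0 < c ->
  (forall h, c * hnorm h <= hnorm (A h)) -> (forall h, exists g, A g = h) ->
  operator_inverse A (inv_operator A) /\
  (forall h, hnorm (inv_operator A h) <= c^-1 * hnorm h).
Proof.
move=> linA c0 cA surA.
have AB x y : A (x - y) = A x - A y.
  by rewrite addrC -scaleN1r linA scaleN1r addrC.
have injA x y : A x = A y -> x = y.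
  move=> xy; apply/eqP; rewrite -subr_eq0; apply/eqP/hnorm_eq0/le_anti.
  rewrite hnorm_ge0 andbT -(pmulr_rle0 _ c0) (le_trans (cA _))//.
  rewrite AB xy subrr.
  by have := hnormZ 0 (0 : hardy R); rewrite scale0r normc0 mul0r => ->.
have bnd B : cancel B A -> forall h, hnorm (B h) <= c^-1 * hnorm h.
  by move=> BA h; rewrite mulrC ler_pdivlMr// mulrC -{2}(BA h).
have [B BA] : exists B, forall h, A (B h) = h.
  exists (fun h => projT1 (cid (surA h))) => h; exact: projT2 (cid (surA h)).
have linB : linear B.
  by move=> a u v; apply: injA; rewrite linA !BA.
have invB : operator_inverse A B.
  split => //; last by move=> x; apply: injA; rewrite BA.
  by split => //; apply: (linear_bounded_continuous_hardy _ c^-1) => //; exact: bnd.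
have inv : operator_inverse A (inv_operator A).
  by rewrite /inv_operator; case: xgetP => // /(_ B).
by split => //; case: inv => _ _ /bnd.
Qed.

Lemma opnorm_le A (K : R) : 0 <= K ->
  (forall h, hnorm (A h) <= K * hnorm h) -> (opnorm A <= K%:E)%E.
Proof.
move=> K0 AK; apply: ub_ereal_sup => _ [h h1 <-]; rewrite lee_fin.
move: h1; rewrite /= !hnormE lecR => h1.
by rewrite (le_trans (AK h))// ler_piMr.
Qed.

Lemma opnorm_ge A h : hnorm h <= 1 -> ((hnorm (A h))%:E <= opnorm A)%E.
Proof. by move=> h1; apply: ereal_sup_ubound; exists h; rewrite //= hnormE lecR. Qed.

End Operators.

(** * The operator [A_beta] *)

Section Abeta.
Context {R : realType}.
Local Notation C := R[i].
Variable b : C.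
Hypothesis b1 : normc b < 1.
Implicit Types (h g : hardy R) (l m : C).

(** Multiplication by [1 + b z]. *)
Definition one_plus_shift h : hardy R := h + b *: hardy_shift h.

Lemma one_plus_shift_linear : linear one_plus_shift.
Proof.
move=> a u v; rewrite /one_plus_shift shift_linear !scalerDr addrACA.
by rewrite !scalerA (mulrC b a).
Qed.

Lemma one_plus_shift_below h : (1 - normc b) * hnorm h <= hnorm (one_plus_shift h).
Proof.
have : hnorm h <= hnorm (one_plus_shift h) + normc b * hnorm h.
  rewrite -{2}(hnorm_shift h) -hnormZ.
  have := ler_hnormD (one_plus_shift h) (- (b *: hardy_shift h)).
  by rewrite addrK hnorm_opp.
lra.
Qed.

Lemma toeplitz_affine_fun : toeplitz (symbol_affine b) = one_plus_shift.
Proof. by apply/funext => h; exact: toeplitz_affine. Qed.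

(** Division by [1 + b z]. *)
Definition invb := inv_operator one_plus_shift.

Lemma invbP : cancel one_plus_shift invb /\ cancel invb one_plus_shift.
Proof.
have sur h : exists g, one_plus_shift g = h.
  have [|g gE] := shift_resolvent (- b) h; first by rewrite normcN.
  by exists g; rewrite /one_plus_shift {1}gE scaleNr addrNK.
have b0 : 0 < 1 - normc b by rewrite subr_gt0.
by have [[]] := bounded_below_inverse _ _ one_plus_shift_linear b0
  one_plus_shift_below sur.
Qed.

(** The function [1 / (1 + b z)], which is the Szego kernel at the conjugate of
    [-b]. *)
Definition szego : hardy R := invb hardy1.

Lemma szegoE : szego + b *: hardy_shift szego = hardy1.
Proof. by have [_ /(_ hardy1)] := invbP. Qed.

Lemma hardy_coef0_szego : hardy_coef0 szego = 1.
Proof.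
by rewrite -hardy_coef0_1 -szegoE hardy_coef0D hardy_coef0Z hardy_coef0_shift mulr0 addr0.
Qed.

Lemma coshift_szego : hardy_coshift szego = - (b *: szego).
Proof.
apply/eqP; rewrite -addr_eq0; apply/eqP.
by rewrite -(coshift1 (R := R)) -szegoE coshiftD coshiftZ shiftK.
Qed.

(** The theorem of Pythagoras for [g = 1 - b S g]. *)
Lemma hnorm_szego : hnorm szego ^+ 2 * (1 - normc b ^+ 2) = 1.
Proof.
have e : szego = 1 *: hardy1 + hardy_shift (- b *: szego).
  by rewrite hardy_shiftZ scale1r scaleNr -[in LHS](addrK (b *: hardy_shift szego) szego) szegoE.
have := hnorm_split 1 (- b *: szego).
rewrite -e hnormZ normcN normc1 expr1n exprMn => {e}.
by move=> e; rewrite mulrBr mulr1 {1}e; ring.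
Qed.

(** Multiplication by [1 + b z] intertwines the operator
    [h |-> B h + b h(0) g] with [B]. *)
Lemma one_plus_shift_A_beta h :
  one_plus_shift (hardy_coshift h + (b * hardy_coef0 h) *: szego) = hardy_coshift (one_plus_shift h).
Proof.
rewrite addrC one_plus_shift_linear {1}/one_plus_shift szegoE.
rewrite /one_plus_shift coshiftK coshiftD coshiftZ shiftK scalerBr scalerA.
by rewrite addrCA; congr (_ + _); rewrite addrC addrNK.
Qed.

Lemma A_betaE h : A_beta b h = hardy_coshift h + (b * hardy_coef0 h) *: szego.
Proof.
rewrite /A_beta toeplitz_affine_fun /= toeplitz_conj -/invb.
by rewrite -one_plus_shift_A_beta invbP.1.
Qed.

Lemma A_beta_linear : linear (A_beta b).
Proof.
move=> a u v; rewrite !A_betaE coshift_linear hardy_coef0_linear mulrDr scalerDl.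
by rewrite scalerDr scalerA addrACA mulrCA.
Qed.

Lemma A_beta_szego : A_beta b szego = 0.
Proof. by rewrite A_betaE coshift_szego hardy_coef0_szego mulr1 addNr. Qed.

Lemma iter_A_beta n h : iter n.+1 (A_beta b) h =
  iter n.+1 hardy_coshift h + (b * hardy_coef0 (iter n hardy_coshift h)) *: szego.
Proof.
elim: n => [|n IHn]; first exact: A_betaE.
by rewrite iterS IHn addrC A_beta_linear A_beta_szego scaler0 add0r A_betaE.
Qed.

Lemma ler_hnorm_iter_coshift n h : hnorm (iter n hardy_coshift h) <= hnorm h.
Proof. by elim: n => //= n IHn; rewrite (le_trans (ler_hnorm_coshift _)). Qed.

Lemma ler_hnorm_iter_A_beta n h :
  hnorm (iter n (A_beta b) h) <= (1 + hnorm szego) * hnorm h.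
Proof.
have s0 := hnorm_ge0 szego; have h0 := hnorm_ge0 h.
case: n => [|n]; first by rewrite /=; nra.
rewrite iter_A_beta (le_trans (ler_hnormD _ _))// mulrDl mul1r lerD//.
  exact: ler_hnorm_iter_coshift.
rewrite hnormZ normcM mulrC ler_wpM2l//.
have := le_trans (ler_normc_coef0 (iter n hardy_coshift h)) (ler_hnorm_iter_coshift n h).
by move=> ch; apply: le_trans ch; rewrite ler_piMl ?normc_ge0 // ltW.
Qed.

Section Resolvent.
Variable l : C.
Hypothesis l1 : 1 < normc l.

Let l0 : l != 0.
Proof. by rewrite -normc_eq0 gt_eqF// (lt_trans _ l1). Qed.

Lemma char_A_beta_solution g :
  char_operator l (A_beta b) (g + (b * hardy_coef0 g / l) *: szego) = l *: g - hardy_coshift g.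
Proof.
rewrite /char_operator [X in A_beta b X]addrC A_beta_linear A_beta_szego scaler0.
rewrite add0r A_betaE scalerDr scalerA (mulrC l) divfK// opprD.
by rewrite addrACA subrr addr0.
Qed.

Lemma coshift_solution h : exists g, l *: g - hardy_coshift g = h.
Proof.
have [|g gE] := coshift_resolvent l^-1 (l^-1 *: h).
  by rewrite normcV invf_lt1// (lt_trans _ l1).
exists g; rewrite {1}gE -scalerDr scalerA mulfV// scale1r.
by rewrite addrK.
Qed.

Lemma coshift_solution_bound g :
  (normc l - 1) * hnorm g <= hnorm (l *: g - hardy_coshift g).
Proof.
have := ler_hnormD (l *: g - hardy_coshift g) (hardy_coshift g).
rewrite addrNK hnormZ; have := ler_hnorm_coshift g; lra.
Qed.

Lemma char_A_beta_linear : linear (char_operator l (A_beta b)).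
Proof.
move=> a u v; rewrite /char_operator A_beta_linear scalerDr scalerBr opprD addrACA.
by rewrite !scalerA (mulrC l a).
Qed.

(** Injectivity is read on [(1 + b z) h], where [A_beta b] acts as the
    contraction [B]. *)
Lemma char_A_beta_inj h : char_operator l (A_beta b) h = 0 -> h = 0.
Proof.
move=> /eqP; rewrite /char_operator subr_eq0 => /eqP lh.
have lE : l *: one_plus_shift h = hardy_coshift (one_plus_shift h).
  rewrite -one_plus_shift_A_beta -A_betaE -lh.
  by rewrite /one_plus_shift scalerDr hardy_shiftZ !scalerA (mulrC b).
have h0 : hnorm (one_plus_shift h) = 0.
  apply/le_anti; rewrite hnorm_ge0 andbT.
  have := coshift_solution_bound (one_plus_shift h); rewrite lE subrr.
  have -> : hnorm (0 : hardy R) = 0 by exact: clnorm0.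
  by rewrite pmulr_rle0 ?subr_gt0.
apply: hnorm_eq0; apply/le_anti; rewrite hnorm_ge0 andbT.
by have := one_plus_shift_below h; rewrite h0 pmulr_rle0 ?subr_gt0.
Qed.

(** By injectivity, [h] is the solution [y + (b y(0) / l) g] attached to its image,
    where [|l| > 1] and [|y(0)| <= |y|]. *)
Lemma char_A_beta_below h :
  (normc l - 1) / (1 + hnorm szego) * hnorm h <= hnorm (char_operator l (A_beta b) h).
Proof.
have [g gE] := coshift_solution (char_operator l (A_beta b) h).
have hE : h = g + (b * hardy_coef0 g / l) *: szego.
  apply/eqP; rewrite -subr_eq0; apply/eqP; apply: char_A_beta_inj.
  rewrite addrC -scaleN1r char_A_beta_linear char_A_beta_solution gE.
  by rewrite scaleN1r addNr.
have s0 := hnorm_ge0 szego; have g0 := hnorm_ge0 g.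
have l10 : 0 < normc l - 1 by rewrite subr_gt0.
have hle : hnorm h <= (1 + hnorm szego) * hnorm g.
  rewrite hE (le_trans (ler_hnormD _ _))// mulrDl mul1r lerD2l hnormZ mulrC.
  rewrite ler_wpM2l// !normcM normcV ler_pdivrMr ?(lt_trans _ l1)//.
  apply: (@le_trans _ _ (hnorm g)); last by rewrite ler_peMr// ltW.
  by apply: le_trans (ler_normc_coef0 g); rewrite ler_piMl ?normc_ge0// ltW.
apply: le_trans (le_trans _ (coshift_solution_bound g)) _; last by rewrite gE.
rewrite mulrAC ler_pdivrMr; last by lra.
by rewrite -mulrA ler_pM2l// (mulrC (hnorm g)).
Qed.

Lemma char_A_beta_inverse :
  operator_inverse (char_operator l (A_beta b)) (inv_operator (char_operator l (A_beta b))) /\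
  (opnorm (inv_operator (char_operator l (A_beta b))) <=
    ((1 + hnorm szego) / (normc l - 1))%:E)%E.
Proof.
have s0 := hnorm_ge0 szego.
have l10 : 0 < normc l - 1 by rewrite subr_gt0.
have c0 : 0 < (normc l - 1) / (1 + hnorm szego) by rewrite divr_gt0//; lra.
have [|inv bnd] := bounded_below_inverse _ _ char_A_beta_linear c0 char_A_beta_below.
  move=> h; have [g gE] := coshift_solution h.
  by exists (g + (b * hardy_coef0 g / l) *: szego); rewrite char_A_beta_solution.
split=> //; apply: opnorm_le; first by rewrite divr_ge0//; lra.
by move=> h; have := bnd h; rewrite invf_div.
Qed.

End Resolvent.

Lemma spectrum_A_beta_le m : spectrum (A_beta b) m -> normc m <= 1.
Proof.
move=> sm; rewrite leNgt; apply/negP => m1; apply: sm.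
by exists (inv_operator (char_operator m (A_beta b))); exact: (char_A_beta_inverse m m1).1.
Qed.

(** The function [k = 1 / (1 - m z)] satisfies [B k = m k], so that
    [k / (1 + b z)] is an eigenvector of [A_beta b]. *)
Lemma spectrum_A_beta_lt m : normc m < 1 -> spectrum (A_beta b) m.
Proof.
move=> m1 [B [_ BK _]].
have [k kE] := shift_resolvent m hardy1 m1.
have ck : hardy_coshift k = m *: k.
  by rewrite {1}kE coshiftD coshift1 add0r coshiftZ shiftK.
have Ak : A_beta b (invb k) = m *: invb k.
  apply: (can_inj invbP.1); rewrite A_betaE one_plus_shift_A_beta invbP.2 ck.
  rewrite -{1}(invbP.2 k) /one_plus_shift scalerDr hardy_shiftZ !scalerA.
  by rewrite (mulrC b).
have c0 : char_operator m (A_beta b) 0 = 0.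
  rewrite /char_operator scaler0 sub0r A_betaE coshift0.
  have -> : hardy_coef0 (0 : hardy R) = 0 by exact: inner0l.
  by rewrite mulr0 scale0r addr0 oppr0.
have ik0 : invb k = 0.
  rewrite -(BK (invb k)) -[RHS](BK 0) c0; congr B.
  by rewrite /char_operator Ak subrr.
have k0 : k = 0 by rewrite -(invbP.2 k) ik0 /one_plus_shift hardy_shift0 scaler0 addr0.
have : hardy_coef0 k = 1 by rewrite kE hardy_coef0D hardy_coef0Z hardy_coef0_shift mulr0 addr0 hardy_coef0_1.
rewrite k0; have -> : hardy_coef0 (0 : hardy R) = 0 by exact: inner0l.
by move/eqP; rewrite eq_sym oner_eq0.
Qed.

Lemma cdist_A_beta_le l : 1 < normc l ->
  (cdist l (spectrum (A_beta b)) <= (normc l - 1)%:E)%E.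
Proof.
move=> l1; apply/lee_addgt0Pr => e e0; rewrite -EFinD.
have l0 : normc l != 0 by rewrite gt_eqF// (lt_trans _ l1).
(* The point of modulus [s < 1] on the ray of [l] is in the spectrum. *)
pose s := Num.max 0 (1 - e).
have s0 : 0 <= s by rewrite le_max lexx.
have s1 : s < 1 by rewrite gt_max ltr01/= ltrBlDr ltrDl.
have se : 1 - e <= s by rewrite le_max lexx orbT.
pose r := s / normc l.
have r0 : 0 <= r by rewrite divr_ge0 ?normc_ge0.
have rl : r * normc l = s by rewrite /r divfK.
apply: (@le_trans _ _ (normc (l - r%:C * l))%:E).
  apply: ereal_inf_lbound; exists (r%:C * l) => //.
  by apply: spectrum_A_beta_lt; rewrite normcM normc_realC ger0_norm// rl.
rewrite lee_fin -{1}(mul1r l) -mulrBl normcM -[1 - _]/(1%:C - r%:C) -rmorphB.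
rewrite normc_realC ger0_norm.
  by rewrite mulrBl mul1r rl; lra.
rewrite subr_ge0 /r ler_pdivrMr ?(lt_trans _ l1)//; lra.
Qed.

Lemma cdist_A_beta_ge l : ((normc l - 1)%:E <= cdist l (spectrum (A_beta b)))%E.
Proof.
apply: le_ereal_inf_tmp => _ [m sm <-]; rewrite lee_fin.
have := spectrum_A_beta_le m sm; have := ler_normcB l m; lra.
Qed.

Lemma power_bound_A_beta_le : (power_bound (A_beta b) <= (1 + hnorm szego)%:E)%E.
Proof.
apply: ub_ereal_sup => _ [n _ <-]; apply: opnorm_le; last exact: ler_hnorm_iter_A_beta.
by have := hnorm_ge0 szego; lra.
Qed.

(** The first power is tested on the constant function 1. *)
Lemma power_bound_A_beta_ge : ((normc b * hnorm szego)%:E <= power_bound (A_beta b))%E.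
Proof.
apply: (@le_trans _ _ (opnorm (iter 1 (A_beta b)))); last first.
  by apply: ereal_sup_ubound; exists 1%N.
have -> : normc b * hnorm szego = hnorm (iter 1 (A_beta b) hardy1).
  by rewrite /= A_betaE coshift1 add0r hardy_coef0_1 mulr1 hnormZ.
by apply: opnorm_ge; rewrite hnorm1.
Qed.

Lemma resolvent_bound_A_beta_le :
  (resolvent_bound (A_beta b) <= (1 + hnorm szego)%:E)%E.
Proof.
apply: ub_ereal_sup => _ [l /= l1 <-].
have l10 : 0 < normc l - 1 by rewrite subr_gt0.
have [_ nle] := char_A_beta_inverse l l1.
apply: (@le_trans _ _ ((normc l - 1)%:E * ((1 + hnorm szego) / (normc l - 1))%:E)%E).
  apply: lee_pmul => //; last exact: cdist_A_beta_le.
  - by apply: le_trans (cdist_A_beta_ge l); rewrite lee_fin ltW.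
  - by apply: le_trans (opnorm_ge _ hardy1 _); rewrite ?lee_fin ?hnorm_ge0 ?hnorm1.
by rewrite -EFinM mulrC divfK// gt_eqF.
Qed.

(** The resolvent at 2 is tested on the constant function 1. *)
Lemma resolvent_bound_A_beta_ge :
  ((normc b * hnorm szego / 4 - 1 / 2)%:E <= resolvent_bound (A_beta b))%E.
Proof.
pose l : C := (2 : R)%:C.
have lE : normc l = 2 by rewrite normc_realC ger0_norm.
have l1 : 1 < normc l by rewrite lE ltr1n.
have l0 : l != 0 by rewrite -normc_eq0 lE pnatr_eq0.
apply: (@le_trans _ _ (cdist l (spectrum (A_beta b)) *
    opnorm (inv_operator (char_operator l (A_beta b))))%E); last first.
  by apply: ereal_sup_ubound; exists l.
have [[_ invK _] _] := char_A_beta_inverse l l1.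
apply: (@le_trans _ _ (opnorm (inv_operator (char_operator l (A_beta b))))).
  apply: le_trans (opnorm_ge _ hardy1 _); last by rewrite hnorm1.
  pose g : hardy R := l^-1 *: hardy1.
  have gE : l *: g - hardy_coshift g = hardy1.
    by rewrite /g scalerA mulfV// scale1r coshiftZ coshift1 scaler0 subr0.
  have := invK (g + (b * hardy_coef0 g / l) *: szego).
  rewrite (char_A_beta_solution _ l1) gE => ->; rewrite lee_fin.
  have := ler_hnormD (g + (b * hardy_coef0 g / l) *: szego) (- 1 *: g).
  rewrite scaleN1r addrAC subrr add0r -scaleN1r !hnormZ !normcM !normcV normcN normc1.
  rewrite hardy_coef0Z hardy_coef0_1 mulr1 normcV lE hnorm1; lra.
rewrite -{1}[X in (X <= _)%E]mul1e lee_wpmul2r//.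
  by apply: le_trans (opnorm_ge _ hardy1 _); rewrite ?lee_fin ?hnorm_ge0 ?hnorm1.
by apply: le_trans (cdist_A_beta_ge l); rewrite lee_fin lE; lra.
Qed.

End Abeta.

(** * The growth estimates *)

Theorem corollary3p1 (R : realType) :
  exists c C r0 : R, [/\ 0 < c, 0 < C, 0 < r0, r0 < 1 &
    forall beta : R[i], r0 < normc beta -> normc beta < 1 ->
      ((c / Num.sqrt (1 - normc beta))%:E <= power_bound (A_beta beta)
         <= (C / Num.sqrt (1 - normc beta))%:E)%E /\
      ((c / Num.sqrt (1 - normc beta))%:E <= resolvent_bound (A_beta beta)
         <= (C / Num.sqrt (1 - normc beta))%:E)%E].
Proof.
(* For [|b| > 99/100], [s = sqrt (1 - |b|)] is at most [1/10] and [|g| s] is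
   between [7/10] and 1; the lower bound for the resolvent then holds because
   [(99/100) (7/10) / 4 - (1/10) / 2 > 1/10]. *)
exists (1 / 10), 2, (99 / 100); split; try lra.
move=> b rb b1.
set s := Num.sqrt (1 - normc b).
have s2 : s ^+ 2 = 1 - normc b by rewrite sqr_sqrtr// subr_ge0 ltW.
have s0 : 0 < s by rewrite sqrtr_gt0 subr_gt0.
have s10 : s <= 1 / 10 by nra.
have g0 := hnorm_ge0 (szego b).
have gE := hnorm_szego b b1.
set g := hnorm (szego b) in g0 gE.
have gs1 : g * s <= 1.
  have : (g * s) ^+ 2 <= 1 by rewrite exprMn s2; nra.
  have : 0 <= g * s by rewrite mulr_ge0// ltW.
  by nra.
have gs2 : 7 / 10 <= g * s.
  have : 1 / 2 <= (g * s) ^+ 2 by rewrite exprMn s2; nra.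
  have : 0 <= g * s by rewrite mulr_ge0// ltW.
  by nra.
have up : 1 + g <= 2 / s by rewrite ler_pdivlMr//; nra.
have lo1 : 1 / 10 / s <= normc b * g by rewrite ler_pdivrMr//; nra.
have lo2 : 1 / 10 / s <= normc b * g / 4 - 1 / 2 by rewrite ler_pdivrMr//; nra.
split; apply/andP; split.
- by apply: le_trans (power_bound_A_beta_ge b b1); rewrite lee_fin.
- by apply: le_trans (power_bound_A_beta_le b b1) _; rewrite lee_fin.
- by apply: le_trans (resolvent_bound_A_beta_ge b b1); rewrite lee_fin.
- by apply: le_trans (resolvent_bound_A_beta_le b b1) _; rewrite lee_fin.
Qed.
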